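(* Let $\lambda\leq\frac18$, let $G$ be a finitely generated group with a (possibly infinite) presentation $\langle A\mid R\rangle$ satisfying the $C'(\lambda)$-condition, and let $\eta$ be a constant with $2\lambda\leq\eta\leq\frac12-2\lambda$. Every element $g\in G$ can be written uniquely as a product $$g=\alpha_1\beta_1\alpha_2\beta_2\cdots\alpha_m\beta_m\alpha_{m+1},$$ such that \begin{itemize} \item the $\beta_i$ are non-trivial $\eta$-relator-covered elements; \item the $\alpha_i$ are $\eta$-compulsory elements (non-trivial with the possible exception of $\alpha_1,\alpha_{m+1}$); \item the vertices $y_i=\alpha_1\beta_1\cdots\alpha_i$ and $z_i=\alpha_1\beta_1\cdots\alpha_i\beta_i$ compose the geodesic sequence determining the $\eta$-criss-cross decomposition of the pair $1,g$. \end{itemize}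
   Context: Small cancelation. Let $A=\{a_1^{\pm1},\dots,a_m^{\pm1}\}$ be a finite alphabet. A set $R$ of nonempty reduced words in $A$ is symmetrized if, with each $r\in R$, it contains $r^{-1}$ and all cyclic permutations of $r$ and $r^{-1}$. $|w|$ denotes the length of a word $w$. For $\lambda\in(0,1)$, a symmetrized set $R$ satisfies $C'(\lambda)$ if: (1) whenever $u$ is a subword of $r\in R$ with $|u|\geq\lambda|r|$, $u$ occurs only once in $r$; (2) whenever $u$ is a common prefix of two distinct words $r_1,r_2\in R$, one has $|u|<\lambda\min\{|r_1|,|r_2|\}$. A presentation $\langle A\mid R\rangle$ ($A$ finite, $R$ symmetrized) satisfies $C'(\lambda)$ if $R$ does. All geodesics and vertices are in the Cayley graph of $G$ with respect to $A$ (edges of length one). $S^\eta(R)$ is the set of words $u$ that are subwords of some $v\in R$ with $\eta|v|\leq|u|\leq\frac12|v|$. A geodesic is $\eta$-relator-tied if it is covered by sub-geodesics labeled by words in $S^\eta(R)$; an $\eta$-relator-tied component of a geodesic is a maximal $\eta$-relator-tied sub-geodesic of it. $\eta$-criss-cross decomposition of a pair of vertices $a,b$: let $(p_1,q_1),\dots,(p_h,q_h)$ be all the pairs of vertices that appear as endpoints of an $\eta$-relator-tied component of some geodesic joining $a$ and $b$. All these vertices lie on every geodesic from $a$ to $b$, in an order independent of the geodesic. Let $\mathfrak g$ be any geodesic from $a$ to $b$ and let $[y_1,z_1],\dots,[y_m,z_m]$ ($m\geq0$) be, in the order in which they appear on $\mathfrak g$, the connected components of $\bigcup_{i=1}^h[p_i,q_i]$,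 where $[p_i,q_i]$ is the sub-geodesic of $\mathfrak g$ with endpoints $p_i,q_i$. The vertices $y_i,z_i$ do not depend on $\mathfrak g$. The geodesic sequence $a,y_1,z_1,\dots,y_m,z_m,b$ determines the $\eta$-criss-cross decomposition of $a,b$, written $(a,y_1),\backslash y_1,z_1/,(z_1,y_2),\backslash y_2,z_2/,\dots,\backslash y_m,z_m/,(z_m,b)$, where the first and last pairs may have equal entries; for $m=0$ the decomposition is $(a,b)$. An element $h\in G$ is $\eta$-compulsory if the decomposition of the pair $1,h$ is $(1,h)$ (i.e. $m=0$), and $\eta$-relator-covered if the decomposition of $1,h$ is $\backslash1,h/$ (i.e. $m=1$, $y_1=1$, $z_1=h$). *)

(* Defs.v *)
From mathcomp Require Import all_boot all_order all_algebra.
From mathcomp Require Import reals.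

Set Implicit Arguments.
Unset Strict Implicit.
Unset Printing Implicit Defensive.

Local Open Scope group_scope.

(* The letter (i, false) stands for a_i and (i, true) for a_i^-1. *)
Definition letter (k : nat) : Type := ('I_k * bool)%type.
Definition word (k : nat) : Type := seq (letter k).

Definition linv (k : nat) (x : letter k) : letter k := (x.1, ~~ x.2).
Definition winv (k : nat) (w : word k) : word k := rev (map (@linv k) w).

Definition reduced (k : nat) (w : word k) : bool :=
  sorted (fun x y : letter k => y != linv x) w.

Definition symmetrized (k : nat) (R : word k -> Prop) : Prop :=
  forall r, R r ->
    [/\ r <> [::], reduced r, R (winv r)
      & forall n, R (rot n r) /\ R (rot n (winv r))].

Definition occurs_once (k : nat) (u r : word k) : Prop :=
  forall x y x' y' : word k,
    r = x ++ u ++ y -> r = x' ++ u ++ y' -> x = x'.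

(* The condition C'(lam); the range lam \in (0, 1) and the requirement that R
   be symmetrized are part of it. *)
Definition small_cancellation (F : realType) (k : nat) (lam : F)
    (R : word k -> Prop) : Prop :=
  [/\ (0 < lam < 1)%R,
      symmetrized R,
      forall u r : word k, R r -> infix u r ->
        (lam * (size r)%:R <= (size u)%:R)%R -> occurs_once u r
    & forall u r1 r2 : word k, R r1 -> R r2 -> r1 <> r2 ->
        prefix u r1 -> prefix u r2 ->
        ((size u)%:R < lam * Num.min (size r1)%:R (size r2)%:R)%R].

(* Words, not necessarily reduced, that represent elements of the normal
   closure of R in the free group; ncl_insert and ncl_delete make the predicate
   invariant under free equality. *)
Inductive normal_closure (k : nat) (R : word k -> Prop) : word k -> Prop :=
| ncl_rel r : R r -> normal_closure R r
| ncl_nil : normal_closure R [::]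
| ncl_cat u v :
    normal_closure R u -> normal_closure R v -> normal_closure R (u ++ v)
| ncl_inv u : normal_closure R u -> normal_closure R (winv u)
| ncl_conj u v : normal_closure R u -> normal_closure R (v ++ u ++ winv v)
| ncl_insert u v x :
    normal_closure R (u ++ v) -> normal_closure R (u ++ [:: x; linv x] ++ v)
| ncl_delete u v x :
    normal_closure R (u ++ [:: x; linv x] ++ v) -> normal_closure R (u ++ v).

Definition eval_letter (G : groupType) (k : nat) (gen : 'I_k -> G)
    (x : letter k) : G :=
  if x.2 then (gen x.1)^-1 else gen x.1.

Definition eval (G : groupType) (k : nat) (gen : 'I_k -> G) (w : word k) : G :=
  \prod_(x <- w) eval_letter gen x.

(* G = < A | R >, where gen sends a_i to the element of G it represents: the
   morphism from the free group is onto, with kernel the normal closure of R. *)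
Definition presents (G : groupType) (k : nat) (gen : 'I_k -> G)
    (R : word k -> Prop) : Prop :=
  (forall g : G, exists w, eval gen w = g) /\
  (forall w, eval gen w = 1 <-> normal_closure R w).

(* An edge path of the Cayley graph is given by its origin a and its label w;
   vertex gen a w i is its i-th vertex, and its edge number i joins the
   vertices number i and i.+1. *)
Definition vertex (G : groupType) (k : nat) (gen : 'I_k -> G)
    (a : G) (w : word k) (i : nat) : G :=
  a * eval gen (take i w).

Definition geodesic (G : groupType) (k : nat) (gen : 'I_k -> G)
    (a b : G) (w : word k) : Prop :=
  a * eval gen w = b /\
  (forall u : word k, a * eval gen u = b -> size w <= size u).

Definition subpath (k : nat) (w : word k) (i j : nat) : word k :=
  drop i (take j w).

(* The set S^eta(R). *)
Definition relator_part (F : realType) (k : nat) (R : word k -> Prop) (eta : F)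
    (u : word k) : Prop :=
  exists v : word k, [/\ R v, infix u v,
    (eta * (size v)%:R <= (size u)%:R)%R
    & ((size u)%:R <= (size v)%:R / 2 :> F)%R].

(* A path with at least one edge is covered by closed subpaths if and only if
   each of its edges is.  A single vertex is never covered, because the words
   of S^eta(R) are nonempty (when 0 < eta). *)
Definition relator_tied (F : realType) (k : nat) (R : word k -> Prop) (eta : F)
    (w : word k) : Prop :=
  w <> [::] /\
  (forall n, n < size w -> exists i j,
     [/\ i <= n, n < j, j <= size w & relator_part R eta (subpath w i j)]).

Definition tied_component (F : realType) (k : nat) (R : word k -> Prop)
    (eta : F) (w : word k) (i j : nat) : Prop :=
  [/\ i <= j, j <= size w, relator_tied R eta (subpath w i j)
    & forall i' j', i' <= i -> j <= j' -> j' <= size w ->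
        relator_tied R eta (subpath w i' j') -> i' = i /\ j' = j].

(* The pairs (p_1, q_1), ..., (p_h, q_h) attached to a, b. *)
Definition tied_pair (F : realType) (G : groupType) (k : nat)
    (gen : 'I_k -> G) (R : word k -> Prop) (eta : F) (a b p q : G) : Prop :=
  exists (w : word k) (i j : nat),
    [/\ geodesic gen a b w, tied_component R eta w i j,
        vertex gen a w i = p & vertex gen a w j = q].

(* The edge number n of the geodesic w from a to b lies in the union of the
   sub-geodesics [p_l, q_l] of w. *)
Definition edge_in_union (F : realType) (G : groupType) (k : nat)
    (gen : 'I_k -> G) (R : word k -> Prop) (eta : F)
    (a b : G) (w : word k) (n : nat) : Prop :=
  exists i j : nat,
    [/\ i <= size w, j <= size w,
        tied_pair gen R eta a b (vertex gen a w i) (vertex gen a w j)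
      & minn i j <= n < maxn i j].

(* [i, j] is a connected component of that union.  Every [p_l, q_l] has at
   least one edge, so the components are the maximal runs of edges. *)
Definition union_component (F : realType) (G : groupType) (k : nat)
    (gen : 'I_k -> G) (R : word k -> Prop) (eta : F)
    (a b : G) (w : word k) (i j : nat) : Prop :=
  [/\ i < j <= size w,
      forall n, i <= n < j -> edge_in_union gen R eta a b w n,
      i = 0 \/ ~ edge_in_union gen R eta a b w i.-1
    & j = size w \/ ~ edge_in_union gen R eta a b w j].

(* a, y_1, z_1, ..., y_m, z_m, b is the geodesic sequence determining the
   eta-criss-cross decomposition of a, b, for s = (y_1, z_1), ..., (y_m, z_m).
   The sequence is read off an arbitrary geodesic, hence the universal
   quantification over w. *)
Definition criss_cross (F : realType) (G : groupType) (k : nat)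
    (gen : 'I_k -> G) (R : word k -> Prop) (eta : F)
    (a b : G) (s : seq (G * G)) : Prop :=
  forall w : word k, geodesic gen a b w ->
    exists t : seq (nat * nat),
      [/\ s = [seq (vertex gen a w c.1, vertex gen a w c.2) | c <- t],
          sorted (fun c d : nat * nat => c.1 < d.1) t
        & forall i j, (i, j) \in t <-> union_component gen R eta a b w i j].

Definition compulsory (F : realType) (G : groupType) (k : nat)
    (gen : 'I_k -> G) (R : word k -> Prop) (eta : F) (h : G) : Prop :=
  criss_cross gen R eta 1 h [::].

Definition relator_covered (F : realType) (G : groupType) (k : nat)
    (gen : 'I_k -> G) (R : word k -> Prop) (eta : F) (h : G) : Prop :=
  criss_cross gen R eta 1 h [:: (1, h)].

(* For s = (alpha_1, beta_1), ..., (alpha_m, beta_m), the pairs (y_i, z_i) with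
   y_i = alpha_1 beta_1 ... alpha_i and
   z_i = alpha_1 beta_1 ... alpha_i beta_i. *)
Definition partial_vertices (G : groupType) (s : seq (G * G)) : seq (G * G) :=
  [seq (\prod_(c <- take i s) (c.1 * c.2) * (nth (1, 1) s i).1,
        \prod_(c <- take i.+1 s) (c.1 * c.2)) | i <- iota 0 (size s)].

(* Main.v *)
Require Import Defs.
From mathcomp Require Import all_boot all_order all_algebra.
From mathcomp Require Import reals boolp zify lra.

(* Two geodesics with the same endpoints bound a ladder of cells.  Each cell of
   the ladder has at most half of its boundary on either side and less than
   [lam] of it on each neighbour, hence at least [1/2 - 2 * lam >= eta] on both
   sides, so that an edge of a geodesic that is in no relator part lies on all
   geodesics with the same endpoints.  Consequently the endpoints of the tied
   components are common to all geodesics, the decomposition can be read off any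
   of them, and it restricts to the sub-geodesics [y_i, z_i] and [z_i, y_i+1].

   The ladder is built cell by cell from Greendlinger's lemma: a cell with more
   than [1 - 3 * lam] of its boundary on a geodesic triangle whose short side is
   a piece must contain that side, since [1/2 + lam <= 1 - 3 * lam] by
   [lam <= 1/8].  For Greendlinger's lemma, take a minimal diagram in which no
   cell has more than [1 - 3 * lam] of its boundary outside and peel off, from
   left to right, the cells along the boundary word.  A peeled cell leaves more
   than [2 * lam] of its boundary behind, of which the next cell covers less
   than [lam].  Any further cell thus meets at most two of the remaining parts,
   each in less than [lam] of its boundary, so that the inner word is a smaller
   counterexample. *)

Set Implicit Arguments.
Unset Strict Implicit.
Unset Printing Implicit Defensive.

Import Order.TTheory GRing.Theory Num.Theory.

(** * Words and their formal inverses *)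

Section Words.

Variable k : nat.
Implicit Types (x y : letter k) (u v w : word k).

Lemma linvK : involutive (@linv k).
Proof. by case=> i b; rewrite /linv /= negbK. Qed.

Lemma winvK : involutive (@winv k).
Proof.
move=> w; rewrite /winv map_rev revK -map_comp -[RHS]map_id.
by apply: eq_map => x; rewrite /= linvK.
Qed.

Lemma winv_cat u v : winv (u ++ v) = winv v ++ winv u.
Proof. by rewrite /winv map_cat rev_cat. Qed.

Lemma winv_cons x w : winv (x :: w) = winv w ++ [:: linv x].
Proof. by rewrite /winv /= rev_cons cats1. Qed.

Lemma winv1 x : winv [:: x] = [:: linv x]. Proof. by []. Qed.

Lemma winv_rcons w x : winv (rcons w x) = linv x :: winv w.
Proof. by rewrite /winv map_rcons rev_rcons. Qed.

Lemma size_winv w : size (winv w) = size w.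
Proof. by rewrite size_rev size_map. Qed.

Lemma winv_eq0 w : winv w = [::] -> w = [::].
Proof. by move/(congr1 size); rewrite size_winv => /size0nil. Qed.

Lemma cons_eq_cons (T : Type) (x y : T) (s t : seq T) :
  x :: s = y :: t -> x = y /\ s = t.
Proof. by case. Qed.

(** Levi's lemma: [e] is the stretch between the two cut points, whichever comes first. *)
Lemma cat_eq_cat (T : Type) (a b c d : seq T) : a ++ b = c ++ d ->
  (exists e, c = a ++ e /\ b = e ++ d) \/ (exists e, a = c ++ e /\ d = e ++ b).
Proof.
elim: a c => [|x a IH] [|y c] /=; first by left; exists [::].
- by move=> ->; left; exists (y :: c).
- by move=> <-; right; exists (x :: a).
- case=> -> /IH [[e [-> ->]]|[e [-> ->]]]; first by left; exists e.
  by right; exists e.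
Qed.

Lemma cat_eq_cat_cons (T : Type) (a b c d : seq T) (y : T) : a ++ b = c ++ y ::
  d ->
  (exists e, c = a ++ e /\ b = e ++ y :: d) \/
  (exists e, a = c ++ y :: e /\ d = e ++ b).
Proof.
case/cat_eq_cat=> [|[[|z e] [-> /= E]]]; first by left.
- by left; exists [::]; rewrite !cats0 -E.
- by case: E => <- ->; right; exists e.
Qed.

End Words.

(** * Van Kampen diagrams through their boundary words *)

Section Diagrams.

Variables (k : nat) (R : word k -> Prop).
Hypothesis symR : symmetrized R.
Implicit Types (x y : letter k) (a b c r s t u v w z : word k).

Lemma R_rot u v : R (u ++ v) -> R (v ++ u).
Proof. by case/symR=> _ _ _ /(_ (size u)) []; rewrite rot_size_cat. Qed.

Lemma R_winv r : R r -> R (winv r).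
Proof. by case/symR. Qed.

(* [null n w] says that [w] bounds a van Kampen diagram with at most [n]
   cells: the edge carrying the first letter of [w] is either glued to another
   boundary edge or peeled off together with the cell that it bounds. *)
Inductive null : nat -> word k -> Prop :=
| null_nil n : null n [::]
| null_fold n1 n2 n x u v : n1 + n2 <= n -> null n1 u -> null n2 v ->
    null n (x :: u ++ linv x :: v)
| null_cell n x t v : R (x :: t) -> null n (winv t ++ v) ->
    null n.+1 (x :: v).

Lemma null_consE n x w : null n (x :: w) ->
  (exists u v n1 n2, [/\ w = u ++ linv x :: v, n1 + n2 <= n, null n1 u
                       & null n2 v]) \/
  (exists t m, [/\ n = m.+1, R (x :: t) & null m (winv t ++ w)]).
Proof.
move Ez: (x :: w) => z H.
case: H Ez => //= [n1 n2 m y u v le nu nv | m y t v Ry nt] [-> ->].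
- by left; exists u, v, n1, n2.
- by right; exists t, m.
Qed.

Lemma null_mono n m w : n <= m -> null n w -> null m w.
Proof.
move=> + H; elim: H m =>
  {n w} [n|n1 n2 n x u v le nu _ nv _|n x t v Rx _ IH] m lem.
- exact: null_nil.
- exact: null_fold (leq_trans le lem) nu nv.
- by case: m lem => // m lem; apply: null_cell Rx (IH _ lem).
Qed.

Lemma null_cat n1 n2 u v : null n1 u -> null n2 v -> null (n1 + n2) (u ++ v).
Proof.
move=> + nv; elim=> {n1 u} [n|m1 m2 n x u1 u2 le nu1 _ _ IH|n x t u Rx _ IH].
- exact: null_mono (leq_addl _ _) nv.
- rewrite /= -catA; apply: null_fold nu1 IH.
  by rewrite addnA leq_add2r.
- by rewrite addSn; apply: null_cell Rx _; rewrite catA.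
Qed.


Lemma null_eq n u v : null n u -> u = v -> null n v.
Proof. by move=> + <-. Qed.


(** Glues two diagrams at a boundary vertex. That vertex lies inside the fold of the first edge,
    behind it, or on what remains after a cell is peeled off, and the induction follows it there. *)
Lemma null_ins n1 n2 z a b :
  null n1 z -> null n2 (a ++ b) -> null (n1 + n2) (a ++ z ++ b).
Proof.
move=> nz; move Ew: (a ++ b) => w nw.
elim: nw a b Ew => {n2 w} [n|m1 m2 n x u v le nu IHu nv IHv|n x t v Rx nv IH]
  [|y a] b //= Ew.
- by rewrite Ew cats0; apply: null_mono nz; apply: leq_addr.
- by rewrite Ew; apply: null_cat => //; apply: null_fold nu nv.
- have le1 : n1 + m1 + m2 <= n1 + n by rewrite -addnA leq_add2l.
  have le2 : m1 + (n1 + m2) <= n1 + n by rewrite addnCA leq_add2l.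
  case: Ew => -> /cat_eq_cat [] [e [Eu Ev]].
  + apply: null_eq (null_fold x le1 (IHu a e (esym Eu)) nv) _.
    by rewrite Ev /= -!catA.
  + case: e Eu Ev => [|y' e] Eu /=; last case=> Ey Ev.
      rewrite cats0 in Eu => <-; rewrite Eu.
      apply: null_eq (null_fold x le1 (IHu u [::] _) nv) _; rewrite ?cats0 //.
      by rewrite -catA.
    apply: null_eq (null_fold x le2 nu (IHv e b (esym Ev))) _.
    by rewrite Eu -Ey /= -catA.
- by rewrite Ew; apply: null_cat => //; apply: null_cell Rx nv.
- case: Ew => -> Ew; rewrite addnS; apply: null_cell Rx _.
  by rewrite catA; apply: IH; rewrite -catA Ew.
Qed.

Lemma null_ins0 n z a b : null 0 z -> null n (a ++ b) -> null n (a ++ z ++ b).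
Proof. by move=> nz nab; rewrite -[n]add0n; apply: null_ins. Qed.

Lemma null_conj x n u : null n u -> null n (x :: u ++ [:: linv x]).
Proof. by move=> nu; apply: null_fold nu (null_nil 0); rewrite addn0. Qed.

Lemma null_rot_of_rot1 n :
  (forall u y, null n (rcons u y) -> null n (y :: u)) ->
  forall u v, null n (u ++ v) -> null n (v ++ u).
Proof.
move=> rot1 u v; elim/last_ind: v u => [|v y IH] u; first by rewrite cats0.
by rewrite -rcons_cat => /rot1 /(IH (y :: u)); rewrite cat_rcons.
Qed.

Lemma rcons_eq_cat_cons (T : Type) (u p q : seq T) (y z : T) :
  rcons u y = p ++ z :: q ->
  (u = p /\ y = z /\ q = [::]) \/ exists2 q', q = rcons q' y & u = p ++ z :: q'.
Proof.
case/lastP: q => [|q y'].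
- by rewrite cats1 => /rcons_inj[-> ->]; left.
- by rewrite -rcons_cons -rcons_cat => /rcons_inj[-> ->]; right; exists q.
Qed.

(** Induction on the cells, then on the length. If [x] bounds a cell, the diagram left has fewer
    cells and can be rotated, which shows where [y] goes: it is glued to the old boundary, lies on
    the same cell, or bounds another cell, and then the two peelings commute. *)
Lemma null_rot1 n u y : null n (rcons u y) -> null n (y :: u).
Proof.
elim/ltn_ind: n u y => n IHn u y.
have IHrot m : m < n -> forall u v, null m (u ++ v) -> null m (v ++ u).
  by move=> ltmn; apply: null_rot_of_rot1 => u' y'; apply: IHn.
move: {2}(size u) (leqnn (size u)) => s; elim: s u y => [|s IHs] u y.
  by rewrite leqn0 => /nilP ->.
case: u => [//|x u] /= lesu /null_consE [].
  move=> [p [q [n1 [n2 [Euy le nu nq]]]]].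
  case: (rcons_eq_cat_cons Euy) => [[-> [-> _]]|[q' Eq Eu]];
    last rewrite Eq in nq.
    have -> : linv x :: x :: p = linv x :: [::] ++ linv (linv x) :: p by
      rewrite linvK.
    apply: null_fold (null_nil 0) _; first exact: leqnn.
    exact: null_mono (leq_trans (leq_addr _ _) le) nu.
  have {}nq : null n2 (y :: q').
    have /predU1P[En|ltn] : (n2 == n) || (n2 < n).
      by rewrite -leq_eqVlt (leq_trans (leq_addl _ _) le).
    - rewrite En in nq *; apply: IHs nq.
      by move: lesu; rewrite Eu size_cat /=; lia.
    - exact: IHn ltn _ _ nq.
  apply: null_mono le _.
  have := null_ins (a := [:: y]) (null_conj x nu) nq.
  by rewrite Eu /= -catA.
move=> [t [m [En Rx]]]; rewrite -cats1 catA => nt; rewrite En.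
have {}nt : null m (y :: winv t ++ u) by apply: IHrot nt; rewrite En.
case/null_consE: nt.
  move=> [p [q [n1 [n2 [E le np nq]]]]].
  case: (cat_eq_cat_cons E) => [[e [Ep Eu]]|[e [Et Eq]]].
    rewrite Ep in np; rewrite Eu.
    have le' : n1.+1 + n2 <= m.+1 by [].
    exact: null_fold (x :: e) _ le' (null_cell Rx np) nq.
  (* The letter [y] lies on the cell of [x], which is peeled off at [y] instead. *)
  have Rt : R (y :: winv p ++ x :: winv e).
    have := congr1 (@winv k) Et; rewrite winvK winv_cat winv_cons linvK => Et'.
    by move: Rx; rewrite Et' -catA /= -cat_cons => /R_rot.
  apply: null_cell Rt _; rewrite winv_cat winv_cons !winvK /= -!catA /=.
  rewrite Eq in nq; apply: null_mono le _.
  by have := null_ins (null_conj (linv x) np) nq; rewrite linvK /= -!catA.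
move=> [t2 [m' [Em Ry nt2]]]; rewrite En Em in IHrot *.
apply: null_cell Ry _; apply: (IHrot m'.+1) => //.
rewrite /=; apply: null_cell Rx _; rewrite catA.
by apply: IHrot => //; rewrite ltnW.
Qed.

Lemma null_rot n u v : null n (u ++ v) -> null n (v ++ u).
Proof. by apply: null_rot_of_rot1 => u' y; apply: null_rot1. Qed.

(** Closes the arc [r] of the boundary with one more cell. This precedes free cancellation because
    [null_delete] relies on it. *)
Lemma null_R_del n r v : R r -> null n (r ++ v) -> null n.+1 v.
Proof.
move=> Rr; elim/ltn_ind: n v => n IHn v.
move: {2}(size v) (leqnn (size v)) => s; elim: s v => [|s IHs] [|z v] //=.
1-2: by move=> _ _; apply: null_nil.
rewrite ltnS => lesv /null_rot /= /null_consE [].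
  move=> [p [q [n1 [n2 [E le np nq]]]]].
  have len2 : n2 <= n by apply: leq_trans le; rewrite leq_addl.
  case: (cat_eq_cat_cons E) => [[e [Ep Er]]|[e [Ev Eq]]].
    have Rz : R (z :: winv e ++ winv q).
      move/R_winv: Rr; rewrite Er winv_cat winv_cons linvK -catA => /R_rot.
      by [].
    rewrite Ep in np; apply: null_cell Rz _; rewrite winv_cat !winvK -catA.
    apply: null_mono le _; rewrite addnC; apply: null_cat => //.
    exact: null_rot.
  rewrite Eq in nq; have {}nq : null n2.+1 e.
    have /predU1P[En|ltn] : (n2 == n) || (n2 < n) by rewrite -leq_eqVlt.
    - rewrite En in nq *; apply: IHs (null_rot nq).
      by move: lesv; rewrite Ev size_cat /=; lia.
    - exact: IHn ltn _ (null_rot nq).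
  by rewrite Ev; apply: null_fold np nq; rewrite addnS ltnS.
move=> [t [m [En Rz]]]; rewrite En catA => /null_rot nt; apply: null_cell Rz _.
by apply: IHn nt; rewrite En.
Qed.

(** Cancelling a pair costs no cell. With the pair in front, a cell peeled off at [y] is absorbed by
    [null_R_del]; otherwise the pair is followed into the parts of the diagram, where a fold may
    separate its two letters. *)
Lemma null_delete n u y v : null n (u ++ y :: linv y :: v) -> null n (u ++ v).
Proof.
suff H N : forall l n u v, n <= N -> size u <= l ->
    null n (u ++ y :: linv y :: v) -> null n (u ++ v) by exact: (H n (size u)).
elim/ltn_ind: N => N IHN; elim=> [|l IHl] {}n {}u {}v len.
  rewrite leqn0 => /nilP -> /= /null_consE [].
    move=> [[|y' p] [q [n1 [n2 [/= E le np nq]]]]].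
      have [_ ->] := cons_eq_cons E.
      by apply: null_mono nq; apply: leq_trans le; apply: leq_addl.
    have [E1 E2] := cons_eq_cons E.
    rewrite E2; apply: null_mono le _; rewrite -cat_rcons; apply: null_cat =>
      //.
    by rewrite -cats1; apply: null_rot; rewrite E1.
  move=> [t [m [-> Ry]]]; rewrite -cat_rcons -cats1 -winv_cons.
  exact: null_R_del (R_winv Ry).
case: u => [|x u] /=; first by move=> _; apply: (IHl n [::]).
rewrite ltnS => leul /null_consE [].
  move=> [p [q [n1 [n2 [E le np nq]]]]].
  have len1 : n1 <= N by apply: leq_trans len; apply: leq_trans le;
    apply: leq_addr.
  have len2 : n2 <= N by apply: leq_trans len; apply: leq_trans le;
    apply: leq_addl.
  case: (cat_eq_cat_cons E) => [[e [Ep Eyv]]|[e [Eu Eq]]].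
    case: e Ep Eyv => [|y1 [|y2 e]] /= Ep Eyv.
    - have [Ey Eq] := cons_eq_cons Eyv.
      rewrite cats0 in Ep; move: nq; rewrite -Eq Ey linvK.
      move=> nq; apply: null_mono le _;
        rewrite -[x :: u ++ v]/([:: x] ++ u ++ v).
      by apply: null_ins => //; rewrite -Ep.
    - have [Ey1 E1] := cons_eq_cons Eyv; have [Ey Eq] := cons_eq_cons E1.
      apply: null_mono le _; rewrite Eq -cat_cons; apply: null_cat => //.
      rewrite -(can_inj (@linvK k) Ey); apply: null_rot1.
      by rewrite -cats1 Ey1 -Ep.
    - have [Ey1 E1] := cons_eq_cons Eyv; have [Ey2 Ev] := cons_eq_cons E1.
      rewrite Ev catA; apply: null_fold le _ nq.
      by apply: IHl => //; rewrite Ey2 Ey1 -Ep.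
  rewrite Eu -catA; apply: null_fold le np _; apply: IHl => //.
    by move: leul; rewrite Eu size_cat /=; lia.
  by rewrite -Eq.
move=> [t [m [En Rx]]]; rewrite catA => nt; rewrite En; apply: null_cell Rx _.
rewrite catA; apply: (IHN m _ _ m) nt => //; first by rewrite -En.
Qed.

Lemma null0_VV s : null 0 (winv s ++ s).
Proof.
elim: s => [|x s IH]; first exact: null_nil.
rewrite winv_cons -catA; apply: (null_ins0 (z := [:: linv x; x])) IH.
by rewrite -{2}(linvK x); apply: (null_conj (linv x) (null_nil 0)).
Qed.

Lemma null0_V s : null 0 (s ++ winv s).
Proof. by rewrite -{1}(winvK s); apply: null0_VV. Qed.

Lemma null_insV n a s b : null n (a ++ b) -> null n (a ++ s ++ winv s ++ b).
Proof. by move=> nab; rewrite (catA s); apply: null_ins0 (null0_V s) nab. Qed.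

Lemma null_delV n a s b : null n (a ++ s ++ winv s ++ b) -> null n (a ++ b).
Proof.
elim/last_ind: s => [//|s x IH]; rewrite winv_rcons cat_rcons catA.
by move/null_delete; rewrite -catA => /IH.
Qed.

Lemma null_insVV n a s b : null n (a ++ b) -> null n (a ++ winv s ++ s ++ b).
Proof. by move/(null_insV (winv s)); rewrite winvK. Qed.

Lemma null_delVV n a s b : null n (a ++ winv s ++ s ++ b) -> null n (a ++ b).
Proof. by rewrite -{2}(winvK s); apply: null_delV. Qed.

Lemma null_R r : R r -> null 1 r.
Proof.
case: r => [/symR[]//|x t] Rr; apply: null_cell Rr _; exact: null0_VV.
Qed.

(** Peels a cell off along a whole arc [u]: the cell is glued on at a vertex, then [t] cancels
    against [winv t]. *)
Lemma null_cellw n a u t b :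
  R (u ++ t) -> null n (a ++ winv t ++ b) -> null n.+1 (a ++ u ++ b).
Proof.
move=> Rut nt; have := null_ins (null_R Rut) nt.
by rewrite add1n -catA (catA a u) => /null_delV; rewrite -catA.
Qed.

Lemma null_winv n w : null n w -> null n (winv w).
Proof.
elim=> {n w} [n|n1 n2 n x u v le _ nu _ nv|n x t v Rx _ nt].
- exact: null_nil.
- rewrite winv_cons winv_cat winv_cons linvK; apply: null_mono le _.
  rewrite -!catA addnC; apply: null_cat => //=.
  exact: null_conj.
- rewrite winv_cons -[_ ++ [:: _]]cats0 -catA.
  apply: (null_cellw (t := winv t)).
    by rewrite -winv1 -winv_cat; apply: R_winv; apply: (R_rot (u := [:: x])).
  by rewrite cats0 -winv_cat.
Qed.

(** One half of van Kampen's lemma: every rule of the normal closure is an operation on diagrams. *)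
Lemma null_normal_closure w : normal_closure R w -> exists n, null n w.
Proof.
elim=> {w} [r Rr||u v _ [n1 nu] _ [n2 nv]|u _ [n nu]|u v _ [n nu]|u v x _ [n
  nu]|u v x _ [n nu]].
- by exists 1; apply: null_R.
- by exists 0; apply: null_nil.
- by exists (n1 + n2); apply: null_cat.
- by exists n; apply: null_winv.
- exists n; rewrite -[n]addn0; apply: null_ins => //; exact: null0_V.
- by exists n; apply: (null_insV [:: x]).
- by exists n; apply: null_delete nu.
Qed.

End Diagrams.

(** * Reduced words and cancellation at a junction *)

Section ReducedWords.

Variable k : nat.
Implicit Types (x y : letter k) (a b u v w : word k).

Definition nocancel u v : Prop := forall a x b, u = rcons a x ->
  v <> linv x :: b.

Lemma nocancel_nill v : nocancel [::] v.
Proof. by move=> [|? ?]. Qed.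

Lemma reduced_cat u v :
  reduced (u ++ v) <-> [/\ reduced u, reduced v & nocancel u v].
Proof.
case: u => [|x u].
  split=> [rv|H]; last by case: H.
  by apply: And3 => //; apply: nocancel_nill.
rewrite /reduced /= cat_path; case: v => [|y v] /=.
  by rewrite andbT; split=> [ru|H]; [apply: And3 | case: H].
split=> [/and3P[ru yx rv]|[-> -> nc]].
  split=> // a z b; rewrite lastI => /rcons_inj[_ <-] E.
  by have [E' _] := cons_eq_cons E; rewrite E' eqxx in yx.
rewrite andbT; apply/eqP => E.
by apply: (nc (belast x u) (last x u) v); rewrite ?lastI ?E.
Qed.

Lemma reduced_catl u v : reduced (u ++ v) -> reduced u.
Proof. by case/reduced_cat. Qed.

Lemma reduced_catr u v : reduced (u ++ v) -> reduced v.
Proof. by case/reduced_cat. Qed.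

Lemma reduced_infix a u b : reduced (a ++ u ++ b) -> reduced u.
Proof. by move/reduced_catr/reduced_catl. Qed.

Lemma nocancel_cat u v w : v <> [::] -> nocancel u v -> nocancel u (v ++ w).
Proof.
by case: v => [//|y v] _ nc a x b /nc{}nc /= E; have [E' _] := cons_eq_cons E;
  apply: (nc v); rewrite E'.
Qed.

Lemma reduced_cat3 u v w : v <> [::] -> reduced u -> reduced v -> reduced w ->
  nocancel u v -> nocancel v w -> reduced (u ++ v ++ w).
Proof.
move=> nv ru rv rw uv vw; apply/reduced_cat; split => //.
  exact/reduced_cat.
exact: nocancel_cat.
Qed.

(** The [nocancel] clause expresses that [p] is the longest common prefix: the remainders do not
    begin with the same letter. *)
Lemma common_prefix (u v : word k) : exists p u' v',
  [/\ u = p ++ u', v = p ++ v' & nocancel (winv u') v'].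
Proof.
elim: u v => [|x u IH] v; first by exists [::], [::], v; split=> //;
  apply: nocancel_nill.
case: v => [|y v].
  by exists [::], (x :: u), [::]; split.
case: (x =P y) => [<-|nxy].
  have [p [u' [v' [-> -> nc]]]] := IH v.
  by exists (x :: p), u', v'.
exists [::], (x :: u), (y :: v); split=> // a z b.
rewrite winv_cons cats1 => /rcons_inj[_ <-] E.
by have [E' _] := cons_eq_cons E; apply: nxy; rewrite E' linvK.
Qed.

Lemma common_suffix (u v : word k) : exists u' v' p,
  [/\ u = u' ++ p, v = v' ++ p & nocancel u' (winv v')].
Proof.
have [p [u' [v' [Eu Ev nc]]]] := common_prefix (winv u) (winv v).
exists (winv u'), (winv v'), (winv p); rewrite -!winv_cat -Eu -Ev !winvK;
  split=> //.
Qed.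

End ReducedWords.

(** * Greendlinger's lemma by sweeping along the boundary *)

Section Greendlinger.

Variables (F : realType) (lam : F) (k : nat) (R : word k -> Prop).
Hypothesis hlam : (lam <= 1 / 8)%R.
Hypothesis hR : small_cancellation lam R.
Implicit Types (x : letter k) (a b c e p q r s t u v w y z : word k).

Let symR : symmetrized R. Proof. by case: hR. Qed.

Lemma lam_gt0 : (0 < lam)%R.
Proof. by case: hR => /andP[]. Qed.

Notation "# w" := ((size w)%:R : F)%R (at level 8, w at level 8, format "# w").

Lemma R_reduced u v w : R (u ++ v ++ w) -> reduced v.
Proof. by case/symR => _ + _ _; apply: reduced_infix. Qed.

Lemma R_nil : ~ R [::].
Proof. by case/symR. Qed.

Lemma pieceP s t t' : R (s ++ t) -> R (s ++ t') ->
  t = t' \/ (#s < lam * #(s ++ t) /\ #s < lam * #(s ++ t'))%R.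
Proof.
move=> Rt Rt'; case: (s ++ t =P s ++ t') => [/eqP|ne].
  by rewrite eqseq_cat // => /andP[_ /eqP]; left.
have [pt pt'] := (prefix_prefix s t, prefix_prefix s t').
right; case: hR => _ _ _ /(_ s _ _ Rt Rt' ne pt pt').
have l0 := lam_gt0.
move=> lt; split; apply: (lt_le_trans lt); apply: ler_wpM2l; first exact: ltW.
- by rewrite ge_min lexx.
- exact: ltW.
- by rewrite ge_min lexx orbT.
Qed.

(** Two cells share the arc [s]. If they are mirror images, they cancel and the path [e] may be
    replaced by the other side [winv z] of its cell; otherwise [s] is a piece of both. *)
Lemma segmentP m c e z a s b t y :
  R (e ++ z) -> e = a ++ s ++ b -> R (s ++ t) ->
  null R m (c ++ a ++ winv t ++ b ++ y) ->
  null R m (c ++ winv z ++ y) \/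
  (#s < lam * #(s ++ t) /\ #s < lam * #(e ++ z))%R.
Proof.
move=> Rez Ee Rst nul.
have Rs : R (s ++ b ++ z ++ a).
  by move: Rez; rewrite Ee -!catA => /(R_rot symR); rewrite -!catA.
case: (pieceP Rst Rs) => [Et|[lt1 lt2]]; [left|right; split=> //].
  rewrite Et !winv_cat -!catA in nul.
  have := null_delV (a := c) (s := a) symR nul.
  by rewrite catA => /(null_delVV symR); rewrite -catA.
by move: lt2; rewrite Ee !size_cat !natrD; lra.
Qed.

(* State of the sweep along [w = v0 ++ y]: [j.+1] cells have been peeled off
   along [v0], and [c ++ e] is the path left behind, [e] being the part of it
   on the last cell, whose inverse boundary is [e ++ z]. *)
Record sweep (j : nat) v0 c e := Sweep {
  sweep_cell : exists2 z, R (e ++ z) /\ (2 * lam * #(e ++ z) < #e)%R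
    & forall m y, null R m (c ++ winv z ++ y) -> null R (m + j) (v0 ++ y);
  sweep_short : forall a s b t m y, c ++ e = a ++ s ++ b -> R (s ++ t) ->
    null R m (a ++ winv t ++ b ++ y) ->
    null R (m + j) (v0 ++ y) \/ (#s < 2 * lam * #(s ++ t))%R;
  sweep_null : forall m y, null R m (c ++ e ++ y) ->
    null R (m + j.+1) (v0 ++ y) }.

Lemma natr_ge0 u : (0 <= #u)%R. Proof. exact: ler0n. Qed.

Lemma lam_mul u : (lam * #u <= 1 / 8 * #u)%R.
Proof. by apply: ler_wpM2r => //; apply: ler0n. Qed.

Lemma sweep_init q t : R (q ++ t) -> (2 * lam * #(q ++ t) < #t)%R ->
  sweep 0 q [::] (winv t).
Proof.
move=> Rqt lt.
have Rtq : R (winv t ++ winv q) by rewrite -winv_cat; apply: R_winv.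
split=> [|a s b t' m y /= Ee Rst nul|m y /= nul].
- exists (winv q); first by split=> //; rewrite -winv_cat !size_winv.
  by move=> m y; rewrite winvK addn0.
- case: (segmentP (c := [::]) Rtq Ee Rst nul) => [|[lts _]].
    by rewrite winvK addn0; left.
  right; apply: lt_le_trans lts _; have := natr_ge0 (s ++ t'); have := lam_gt0.
  by nra.
- by rewrite addn1; apply: (null_cellw symR (a := [::]) Rqt nul).
Qed.

(* The next cell [p ++ q ++ t] meets the swept path along its end [p]. *)
Lemma sweep_next j v0 c e e1 p q t : sweep j v0 c e -> e = e1 ++ p ->
  R (p ++ q ++ t) -> (2 * lam * #(p ++ q ++ t) < #t)%R ->
  (forall z, R (e ++ z) -> (2 * lam * #(e ++ z) < #e)%R ->
     (forall m y, null R m (c ++ winv z ++ y) -> null R (m + j) (v0 ++ y)) ->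
     (#p < lam * #(e ++ z))%R) ->
  sweep j.+1 (v0 ++ q) (c ++ e1) (winv t).
Proof.
move=> [[z [Rez lte] Le] Ke Te] Ee Rpqt ltt ltp.
have {}ltp := ltp z Rez lte Le.
have Rt : R (winv t ++ winv (p ++ q)).
  by rewrite -winv_cat -catA; apply: R_winv.
have L' m y : null R m ((c ++ e1) ++ winv (winv (p ++ q)) ++ y) ->
    null R (m + j.+1) ((v0 ++ q) ++ y).
  move=> nul; rewrite -catA; apply: Te; rewrite Ee; apply: null_eq nul _.
  by rewrite winvK -!catA.
have cellE m a b : null R m (a ++ winv t ++ b) ->
  null R m.+1 (a ++ p ++ q ++ b).
  have Rt' : R ((p ++ q) ++ t) by rewrite -catA.
  by move/(null_cellw symR Rt'); rewrite -catA.
split=> [|a s b t' m y E Rst nul|m y nul].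
- exists (winv (p ++ q)); last exact: L'.
  by split => //; rewrite -winv_cat !size_winv -catA.
- have l0 := lam_gt0; have f0 := natr_ge0 (s ++ t').
  have fin : (#s < lam * #(s ++ t'))%R -> (#s < 2 * lam * #(s ++ t'))%R by nra.
  (* The arc [s] lies inside [winv t], or ends before it, or straddles the junction as [d ++ s2]. *)
  case: (cat_eq_cat E) => [[a' [Ea Et]]|[d [Ec Esb]]].
    rewrite Ea -!catA in nul.
    case: (segmentP (c := c ++ e1) Rt Et Rst (m := m) (y := y)).
    - by rewrite -!catA; exact: nul.
    - by move/L'; left.
    - by case=> /fin; right.
  case: (cat_eq_cat (esym Esb)) => [[s2 [Es Et]]|[b' [Es Eb]]]; last first.
    have {}nul : null R m.+1 (a ++ winv t' ++ (b' ++ p) ++ q ++ y).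
      have := cellE m (a ++ winv t' ++ b') y; rewrite -!catA; apply.
      by move: nul; rewrite Eb -!catA.
    rewrite -addSnnS -catA; apply: Ke Rst nul.
    by rewrite Ee catA Ec Es -!catA.
  have R2 : R (s2 ++ t' ++ d).
    by move: Rst; rewrite Es -catA => /(R_rot symR); rewrite -catA.
  have nul1 : null R m ((c ++ e1) ++ [::] ++ winv (t' ++ d) ++ b ++ y).
    by rewrite winv_cat Ec -!catA; apply: null_insV.
  case: (segmentP (a := [::]) Rt Et R2 nul1) => [/L'|[lt2 _]]; first by left.
  (* Gluing the last cell back costs one cell and returns to the path of the previous stage. *)
  have {}nul : null R m.+1 (a ++ winv t' ++ winv s2 ++ p ++ q ++ y).
    have := cellE m (a ++ winv t' ++ winv s2) y; rewrite -!catA; apply.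
    by rewrite Et -!catA; have := @null_insVV _ R m (a ++ winv t') s2 (b ++ y);
      rewrite -!catA; apply.
  have R1 : R (d ++ s2 ++ t') by rewrite catA -Es.
  rewrite -addSnnS -catA.
  case: (cat_eq_cat Ec) => [[a1 [Ea Ee1]]|[d1 [Ec1 Ed]]].
    have nul2 : null R m.+1 (c ++ a1 ++ winv (s2 ++ t') ++ p ++ (q ++ y)).
      by move: nul; rewrite Ea winv_cat -!catA.
    have Ee' : e = a1 ++ d ++ p by rewrite Ee Ee1 -catA.
    case: (segmentP Rez Ee' R1 nul2) => [/Le|[lt1 _]]; first by left.
    right; move: lt1 lt2; rewrite Es !size_cat !natrD; lra.
  (* Here [d] contains all of [e1], which is then a piece. As [p] is below [lam] too, [e = e1 ++ p]
     would be below [2 * lam] of its cell, against [lte]. *)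
  have {}R2 : R (e1 ++ s2 ++ t' ++ d1).
    by move: R1; rewrite Ed -catA => /(R_rot symR); rewrite -!catA.
  have nul2 : null R m.+1 (c ++ [::] ++ winv (s2 ++ t' ++ d1) ++ p ++ (q ++ y)).
    by rewrite !winv_cat Ec1 -!catA; apply: null_insV.
  case: (segmentP (a := [::]) Rez Ee R2 nul2) => [/Le|[_ lt1]]; first by left.
  by move: lt1 ltp lte; rewrite Ee !size_cat !natrD; lra.
- rewrite -addSnnS -catA; apply: Te; rewrite Ee.
  by have := cellE _ _ _ nul; rewrite -!catA.
Qed.

(** The exposed cell of Greendlinger's lemma: [s] is its outer arc, [t] its inner one, and [n]
    bounds the number of cells left without it. *)
Definition shell n w : Prop := exists a s b t,
  [/\ w = a ++ s ++ b, R (s ++ t), ((1 - 3 * lam) * #(s ++ t) < #s)%R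
    & null R n (a ++ winv t ++ b)].

Lemma reduced_pair a x b : ~ reduced (a ++ x :: linv x :: b).
Proof.
rewrite -cat_rcons => /reduced_cat[_ _ nc].
exact: (nc a x b).
Qed.

Lemma shell_infix n m a u b w : shell n u ->
  (forall v, null R n v -> null R m (a ++ v ++ b)) -> w = a ++ u ++ b ->
    shell m w.
Proof.
move=> [a' [s [b' [t [-> Rst lt nul]]]]] H ->.
by exists (a ++ a'), s, (b' ++ b), t; split; rewrite -?catA //; have := H _ nul;
  rewrite -!catA.
Qed.

(** Induction on the unswept part [y]. The next cell of the remaining diagram extends the sweep
    until [y] is exhausted; the swept path would then have a shell by [IH], which [sweep_short]
    forbids. *)
Lemma sweep_false N w :
    (forall m u, m <= N -> reduced u -> u <> [::] -> null R m u ->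
       exists2 m', m' < m & shell m' u) ->
    ~ null R N w -> ~ shell N w ->
  forall j v0 c e M y, sweep j v0 c e -> w = v0 ++ y -> M + j = N ->
    reduced (c ++ e ++ y) -> ~ null R M (c ++ e ++ y).
Proof.
move=> IH minw nsw j v0 c e M y; move: {2}(size y) (leqnn (size y)) => l.
elim: l y j v0 c e M => [|l IHl] y j v0 c e M ley sw Ew EN red nul.
all: have l0 := lam_gt0.
all: have [[z [Rez lte] Le] Ke Te] := sw.
(* A shell on the swept path would have an arc below [2 * lam] of its cell, while
   [2 * lam < 1 - 3 * lam], or would yield a diagram for [w] with at most [N] cells. *)
all: have nshort m' a s b t : m' < M -> c ++ e = a ++ s ++ b -> R (s ++ t) ->
  null R m' (a ++ winv t ++ b ++ y) -> ((1 - 3 * lam) * #(s ++ t) < #s)%R ->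
    False.
1,3: move=> lt E Rst nul' lts; case: (Ke a s b t m' y E Rst nul').
1,3: by rewrite -Ew => /null_mono H; apply/minw/H; lia.
1,2: by move=> lts'; have := natr_ge0 (s ++ t); have := lam_mul (s ++ t);
  move: lts lts'; lra.
all: have ne : e <> [::].
1,3: by move=> E; move: lte; rewrite E /= => lte; have := natr_ge0 z; nra.
  move: ley; rewrite leqn0 => /nilP Ey; rewrite Ey in Ew red nul nshort.
  rewrite cats0 in red nul.
  have [||m' lt [a [s [b [t [E Rst lts nul']]]]]] := IH _ _ _ red _ nul.
  - by lia.
  - by case: (c) ne => // ->.
  - by apply: (nshort m' a s b t) => //; rewrite cats0.
case: y => [|x y0] in ley Ew red nul nshort *.
  exact: (IHl [::] j v0 c e M).
move: (nul); rewrite catA => /(null_rot symR) /= /null_consE [].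
  move=> [u [v [n1 [n2 [E le nu nv]]]]].
  case: (cat_eq_cat_cons E) => [[d [Eu Ece]]|[d [Ey Ev]]].
    have [|||m' lt [a [s [b [t [Ev Rst lts nul']]]]]] := IH n2 v _ _ _ nv.
    - by lia.
    - move: red; rewrite catA Ece -catA => /reduced_catr/reduced_catl.
      exact: (reduced_catr (u := [:: linv x])).
    - move=> Ev; move: red; rewrite catA Ece Ev -catA /= -{2}(linvK x).
      exact: reduced_pair.
    - apply: (nshort (m' + n1) (d ++ linv x :: a) s b t) => //; first by lia.
        by rewrite Ece Ev -!catA.
      rewrite Eu in nu.
      have := null_ins (null_conj (linv x) nul') (null_rot symR nu).
      by rewrite linvK /= -!catA.
    have [|||m' lt shu] := IH n1 u _ _ _ nu.
    - by lia.
    - by move: red; rewrite Ey catA -cat_cons => /reduced_catr /=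
      /(reduced_catr (u := [:: x])) /reduced_catl.
    - by move=> Eu; move: red; rewrite Ey Eu catA; exact: reduced_pair.
    apply: nsw; apply: (shell_infix (a := v0 ++ [:: x]) (b :=
      linv x :: d)) shu _ _.
      move=> v' nv'; have /null_mono nulv : m' + n2 + j.+1 <= N by lia.
      apply: nulv; rewrite -!catA; apply: Te; rewrite Ev in nv.
      have := null_ins (null_conj x nv') (null_rot symR nv).
      by rewrite /= -!catA.
    by rewrite Ew Ey -!catA.
move=> [t0 [M' [EM Rxt]]] nul'.
have [q0 [t1 [y' [Et0 Ey0 nc1]]]] := common_prefix t0 y0.
have {}nul' : null R M' ((c ++ e) ++ winv t1 ++ y').
  apply: (null_rot symR); rewrite -catA; move: nul'.
  by rewrite Et0 Ey0 winv_cat -!catA => /(null_delVV symR).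
set q := x :: q0.
have Rqt1 : R (q ++ t1) by rewrite /q /= -Et0.
have leq : (#q <= (1 - 3 * lam) * #(q ++ t1))%R.
  rewrite leNgt; apply/negP => ltq; apply: nsw; exists v0, q, y', t1; split=>
    //.
    by rewrite Ew Ey0.
  have <- : M' + j.+1 = N by lia.
  by apply: Te; rewrite catA.
(* The overlaps [q] with [y] and [p] with the swept path are taken maximal, so that the new path
   stays reduced. *)
have [c1 [t [p [Ece Et1 nc2]]]] := common_suffix (c ++ e) t1.
have Rpqt : R (p ++ q ++ t).
  by apply: (R_rot symR); rewrite -catA -Et1.
have {}nul' : null R M' (c1 ++ winv t ++ y').
  by move: nul'; rewrite Ece Et1 winv_cat -!catA => /(null_delV symR).
have sizef : (#(q ++ t1) = #(p ++ q ++ t))%R.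
  by rewrite Et1 !size_cat !natrD; lra.
have minLe z' : (forall m y, null R m (c ++ winv z' ++ y) ->
  null R (m + j) (v0 ++ y)) ->
    ~ null R M' (c ++ winv z' ++ q ++ y').
  by move=> Lz /Lz; rewrite /q /= -Ey0 -Ew => /null_mono H; apply/minw/H; lia.
(* If [p] covered all of [e], then [e] would be a piece, although it exceeds [2 * lam] of its
   cell. *)
have [e1 Ec1 Ee] : exists2 e1, c1 = c ++ e1 & e = e1 ++ p.
  case: (cat_eq_cat Ece) => [[e1 [-> ->]]|[p' [Ec Ep]]]; first by exists e1.
  have Re : R (e ++ q ++ t ++ p').
    by move: Rpqt; rewrite Ep -catA => /(R_rot symR); rewrite -!catA.
  have nule : null R M' (c ++ [::] ++ winv (q ++ t ++ p') ++ [::] ++ q ++ y').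
    rewrite !winv_cat Ec -!catA; apply: null_insV.
    by rewrite catA; apply: null_insVV; rewrite -catA.
  case: (segmentP (a := [::]) (b := [::]) Rez _ Re nule) =>
    [|/minLe//|[_ lte']].
    by rewrite cats0.
  by have := lte; have := natr_ge0 (e ++ z); move: lte'; nra.
have nule : null R M' (c ++ e1 ++ winv (q ++ t) ++ [::] ++ q ++ y').
  rewrite winv_cat -!catA.
  by have := @null_insVV _ R M' (c ++ e1 ++ winv t) q y'; rewrite -!catA; apply;
    rewrite catA -Ec1.
have Ee' : e = e1 ++ p ++ [::] by rewrite cats0.
have ltp z' : R (e ++ z') -> (forall m y, null R m (c ++ winv z' ++ y) ->
  null R (m + j) (v0 ++ y)) ->
    (#p < lam * #(p ++ q ++ t) /\ #p < lam * #(e ++ z'))%R.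
  by move=> Rz' Lz; case: (segmentP Rz' Ee' Rpqt nule) => [/(minLe _ Lz)|].
have [ltp1 _] := ltp z Rez Le.
(* At most [1 - 3 * lam] of the cell is in [q] and less than [lam] in [p]. *)
have ltt : (2 * lam * #(p ++ q ++ t) < #t)%R.
  by move: leq ltp1; rewrite sizef !size_cat !natrD; lra.
have nt : t <> [::].
  by move=> E; move: ltt; rewrite [in X in (_ < X)%R]E /=; have :=
    natr_ge0 (p ++ q ++ t); nra.
apply: (IHl y' j.+1 (v0 ++ q) c1 (winv t) M') => //.
- by move: ley; rewrite Ey0 /= size_cat; lia.
- by rewrite Ec1; apply: sweep_next sw Ee Rpqt ltt _ => z' Rz' _ Lz;
  case: (ltp z' Rz' Lz).
- by rewrite Ew Ey0 -catA.
- by lia.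
- apply: reduced_cat3 => //.
  + by move/winv_eq0.
  + by move: red; rewrite catA Ece -catA => /reduced_catl.
  + by apply: (R_reduced (u := [::]) (w := winv (p ++ q))); rewrite /=
    -winv_cat -catA; apply: R_winv.
  + by move: red; rewrite catA => /reduced_catr; rewrite Ey0 -cat_cons =>
    /reduced_catr.
  + move=> a z' b Ea; apply: (nc1 (winv p ++ a)).
    by rewrite Et1 winv_cat Ea rcons_cat.
Qed.

(** A diagram without cells is a tree: an innermost fold would be a cancelling pair. *)
Lemma null0_reduced w : reduced w -> null R 0 w -> w = [::].
Proof.
move: {2}(size w) (leqnn (size w)) => l; elim: l w => [|l IH] [|x w] //.
rewrite [size _]/= ltnS =>
  lew red /null_consE [[u [v [n1 [n2 [E le nu _]]]]]|[t [m []]]//].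
have /nilP Eu : nilp u.
  apply/nilP/IH.
  - by move: lew; rewrite E size_cat /=; lia.
  - by move: red; rewrite E -cat_cons => /reduced_catl /(reduced_catr (u :=
    [:: x])).
  - by apply: null_mono nu; lia.
by move: red; rewrite E Eu => /(reduced_pair (a := [::])).
Qed.

(** Induction on the cells, then on the length. A fold of the first edge encloses a shorter word;
    otherwise the cell at that edge, if it is not a shell itself, starts a sweep. *)
Lemma null_shell N w : reduced w -> w <> [::] -> null R N w ->
  exists2 m, m < N & shell m w.
Proof.
suff H : forall l N' w, N' <= N -> size w <= l -> reduced w -> w <> [::] ->
    null R N' w -> exists2 m, m < N' & shell m w by exact: (H (size w)).
elim/ltn_ind: N {w} => N IHN; elim=> [|l IHl] n w len lew red nw nul.
  by move: lew nw; rewrite leqn0 => /nilP.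
case: n => [|n] in len nul *; first by case: nw; apply: null0_reduced.
have IH m u : m <= n -> reduced u -> u <> [::] -> null R m u ->
    exists2 m', m' < m & shell m' u.
  by move=> lem; apply: (IHN m _ (size u) m u) => //; lia.
case: (EM (null R n w)) => [nuln|minw].
  by case: (IH n w _ red nw nuln) => // m lt; exists m => //; lia.
case: (EM (shell n w)) => [|nsw]; first by exists n.
case: w => [//|x w] in lew red nw nul minw nsw *.
case/null_consE: (nul) => [[u [v [n1 [n2 [E le nu nv]]]]]|].
  have [||||m' lt shu] := IHl n1 u _ _ _ _ nu.
  - by lia.
  - by move: lew; rewrite E /= size_cat /=; lia.
  - by move: red; rewrite E -cat_cons => /reduced_catl /(reduced_catr (u :=
    [:: x])).
  - by move=> Eu; move: red; rewrite E Eu => /(reduced_pair (a := [::])).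
  case: nsw; apply: (shell_infix (a := [:: x]) (b := linv x :: v)) shu _ _.
    by move=> v' nv'; apply: null_fold nv' nv; lia.
  by rewrite E.
move=> [t0 [_ [[<-] Rxt nul']]].
have [q0 [t [y' [Et0 Ew nc]]]] := common_prefix t0 w.
have {}nul' : null R n (winv t ++ y').
  by move: nul'; rewrite Et0 Ew winv_cat -!catA => /(null_delVV symR).
set q := x :: q0.
have Rqt : R (q ++ t) by rewrite /q /= -Et0.
have leq : (#q <= (1 - 3 * lam) * #(q ++ t))%R.
  rewrite leNgt; apply/negP => ltq; apply: nsw; exists [::], q, y', t; split=>
    //.
  by rewrite Ew.
have l0 := lam_gt0.
have ltf : (0 < lam * #(q ++ t))%R by rewrite pmulr_rgt0 // ltr0n.
have ltt : (2 * lam * #(q ++ t) < #t)%R.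
  by move: leq ltf; rewrite !size_cat !natrD; lra.
have nt : t <> [::].
  by move=> E; move: ltt ltf; rewrite [in X in (_ < X)%R]E /=; lra.
case: (sweep_false IH minw nsw (sweep_init Rqt ltt) (M := n) (y := y')) => //.
- by rewrite Ew.
- by rewrite addn0.
- rewrite cat0s; apply/reduced_cat; apply: And3 => //.
    by apply: (R_reduced (u := [::]) (w := winv q)); rewrite cat0s -winv_cat;
      apply: R_winv.
  by move: red; rewrite Ew -cat_cons => /reduced_catr.
Qed.

Lemma greendlinger w : reduced w -> w <> [::] -> normal_closure R w ->
  exists a s b t,
    [/\ w = a ++ s ++ b, R (s ++ t) & ((1 - 3 * lam) * #(s ++ t) < #s)%R].
Proof.
move=> red nw /(null_normal_closure symR) [n /(null_shell red nw)].
by case=> m _ [a [s [b [t [E Rst lt _]]]]]; exists a, s, b, t.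
Qed.

End Greendlinger.

(** * Evaluation in the group and geodesic words *)

Section Eval.

Variables (G : groupType) (k : nat) (gen : 'I_k -> G).
Implicit Types (x : letter k) (u v w : word k).
Local Open Scope group_scope.

Lemma eval_nil : eval gen [::] = 1.
Proof. by rewrite /eval big_nil. Qed.

Lemma eval_cat u v : eval gen (u ++ v) = eval gen u * eval gen v.
Proof. by rewrite /eval big_cat. Qed.

Lemma eval_winv u : eval gen (winv u) = (eval gen u)^-1.
Proof.
elim: u => [|x u IH]; first by rewrite eval_nil invg1.
rewrite winv_cons eval_cat IH -(cat1s x u) eval_cat invgM; congr (_ * _).
rewrite /eval !big_seq1 /eval_letter /=.
by case: x.2; rewrite /= ?invgK.
Qed.

(** Geodesic labels: by translation invariance the origin of the path does not matter. *)
Definition geo w : Prop := forall u, eval gen u = eval gen w ->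
  size w <= size u.

Lemma geo_infix a u b : geo (a ++ u ++ b) -> geo u.
Proof.
move=> gw v Ev; have := gw (a ++ v ++ b); rewrite !eval_cat Ev => /(_ erefl).
by rewrite !size_cat; lia.
Qed.

Lemma geo_catl u v : geo (u ++ v) -> geo u.
Proof. exact: (@geo_infix [::]). Qed.

Lemma geo_catr u v : geo (u ++ v) -> geo v.
Proof. by move=> g; apply: (@geo_infix u v [::]); rewrite cats0. Qed.

Lemma geo_winv w : geo w -> geo (winv w).
Proof.
move=> gw u Eu; rewrite size_winv -(size_winv u); apply: gw.
by rewrite eval_winv Eu eval_winv invgK.
Qed.

Lemma geo_reduced w : geo w -> reduced w.
Proof.
elim: w => [|x [|y w] IH] // gw; rewrite /reduced /=; apply/andP; split.
  apply/eqP => Ey; have := gw w; rewrite -(cat1s x) -(cat1s y) !eval_cat Ey.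
  rewrite -winv1 eval_winv mulVKg => /(_ erefl); rewrite /=; lia.
by apply: IH; apply: (geo_catr (u := [:: x])).
Qed.

Lemma geo_size u v : geo u -> geo v -> eval gen u = eval gen v ->
  size u = size v.
Proof. by move=> gu gv E; apply/eqP; rewrite eqn_leq gu // gv. Qed.

End Eval.

(** * Ladders of cells between two geodesics *)

Section Bigons.

Variables (F : realType) (lam eta : F) (G : groupType) (k : nat).
Variables (gen : 'I_k -> G) (R : word k -> Prop).
Hypothesis hlam : (lam <= 1 / 8)%R.
Hypothesis hG : presents gen R.
Hypothesis hR : small_cancellation lam R.
Hypothesis heta : (eta <= 1 / 2 - 2 * lam)%R.

Implicit Types (x : letter k) (a b c d e r s t u v w y z : word k).

Notation "# w" := ((size w)%:R : F)%R (at level 8, w at level 8, format "# w").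
Notation eval := (eval gen).
Notation geo := (geo gen).

Let symR : symmetrized R. Proof. by case: hR. Qed.

Lemma eval_R r : R r -> (eval r = 1)%g.
Proof. by case: hG => _ H Rr; apply/H; apply: ncl_rel. Qed.

Lemma greendlinger_eval w : reduced w -> w <> [::] -> eval w = 1%g ->
  exists a s b t,
    [/\ w = a ++ s ++ b, R (s ++ t) & ((1 - 3 * lam) * #(s ++ t) < #s)%R].
Proof. by case: hG => _ H red nw /H; apply: greendlinger. Qed.

(** The complementary arc [winv t] has the same value as [s], so it is at least as long. *)
Lemma geo_half s t : geo s -> R (s ++ t) -> (#s <= 1 / 2 * #(s ++ t))%R.
Proof.
move=> gs /eval_R; rewrite eval_cat => /mulg1_eq E.
have := gs (winv t); rewrite eval_winv -E invgK => /(_ erefl).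
rewrite size_winv -(ler_nat F) size_cat natrD; lra.
Qed.

Definition covered w n : Prop := exists i j,
  [/\ i <= n, n < j, j <= size w & relator_part R eta (subpath w i j)].

(** A vertex common to two geodesics has the same distance from the origin on both, hence the single
    index [n]. *)
Definition common_edge u v n : Prop := [/\ n < size v,
  eval (take n u) = eval (take n v) & eval (take n.+1 u) = eval (take n.+1 v)].

Definition laddered u v : Prop := forall n, n < size u ->
  covered u n \/ common_edge u v n.

Lemma covered_catl u v n : covered u n -> covered (u ++ v) n.
Proof.
move=> [i [j [le lt lej rp]]]; exists i, j; split => //.
  by rewrite size_cat (leq_trans lej) ?leq_addr.
by rewrite /subpath takel_cat.
Qed.

Lemma common_edge_cat u v u' v' n : n < size u ->
  common_edge u v n -> common_edge (u ++ u') (v ++ v') n.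
Proof.
move=> ltu [ltv E E']; split; first by rewrite size_cat ltn_addr.
  by rewrite !takel_cat // ltnW.
by rewrite !takel_cat.
Qed.

Lemma laddered_cat u v u' v' : laddered u v -> relator_part R eta u' ->
  laddered (u ++ u') (v ++ v').
Proof.
move=> lad rp n; case: (ltnP n (size u)) => [lt _|le].
  case: (lad n lt) => [cov|com]; first by left; apply: covered_catl.
  by right; apply: common_edge_cat.
move=> lt; left; exists (size u), (size (u ++ u')); split => //.
by rewrite /subpath take_size drop_size_cat.
Qed.

Definition bigon_ladders l : Prop := forall u v, size u <= l ->
  geo u -> geo v -> eval u = eval v -> laddered u v.

(** What is left of a bigon after a cell is removed: [t] is the side along that cell and [z] the
    rest of its boundary. The [nocancel] conditions keep the next cell from being its mirror image;
    [t] is then a piece, which improves [3 * lam] to [lam]. *)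
Definition triangle_ladders l : Prop := forall u v t z, size u <= l ->
  geo u -> geo v -> t <> [::] -> z <> [::] -> R (t ++ z) ->
  reduced (u ++ t ++ winv v) ->
  nocancel u (winv z) -> nocancel (winv z) (winv v) ->
  (#t < 3 * lam * #(t ++ z))%R -> eval (u ++ t) = eval v ->
  (#t < lam * #(t ++ z))%R /\ laddered u v.

Lemma nocancel_catl u v w : v <> [::] -> nocancel v w -> nocancel (u ++ v) w.
Proof.
case/lastP: v => [//|v x] _ nc a y b; rewrite -rcons_cat => /rcons_inj[_ <-].
exact: nc.
Qed.

(* Peeling off the cell with boundary [s1 ++ t ++ s3 ++ c] that contains the
   corner of the two geodesics, cut off by [t]. *)
Lemma ladder_step l u v a b s1 s3 t c :
  bigon_ladders l -> triangle_ladders l -> size u <= l.+1 -> geo u -> geo v ->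
  u = a ++ s1 -> winv v = s3 ++ b -> s1 <> [::] -> s3 <> [::] ->
  R (s1 ++ t ++ s3 ++ c) ->
  (#t < lam * #(s1 ++ t ++ s3 ++ c))%R ->
  (#c < 3 * lam * #(s1 ++ t ++ s3 ++ c))%R ->
  eval (u ++ t) = eval v -> laddered u v.
Proof.
move=> IHA IHB leu gu gv Eu Ev ns1 ns3 Rf ltt ltc Euv.
have l0 : (0 < lam)%R := lam_gt0 hR.
(* The cell is extended along both geodesics as far as possible; [c2] is the side it leaves
   inside. *)
have [p [c1 [b1 [Ec Eb nc1]]]] := common_prefix c b.
have [a1 [c2 [q [Ea Ec1 nc2]]]] := common_suffix a c1.
pose S1 := q ++ s1; pose S3 := s3 ++ p; pose f := S1 ++ t ++ S3 ++ c2.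
have Rf' : R f.
  rewrite /f /S1 -catA; apply: (R_rot symR).
  by move: Rf; rewrite Ec Ec1 /S3 -!catA.
have sf : (#(s1 ++ t ++ s3 ++ c) = #f)%R.
  by rewrite Ec Ec1 /f /S1 /S3 !size_cat !natrD; lra.
have Eu1 : u = a1 ++ S1 by rewrite Eu Ea -catA.
have Ev1 : winv v = S3 ++ b1 by rewrite Ev Eb /S3 -catA.
have nS1 : S1 <> [::] by rewrite /S1; case: (q).
have nS3 : S3 <> [::] by rewrite /S3; case: (s3) ns3.
have Ev2 : v = winv b1 ++ winv S3 by rewrite -[v]winvK Ev1 winv_cat.
clearbody S1 S3.
have Eab : eval (a1 ++ winv c2) = eval (winv b1).
  have := eval_R Rf'; rewrite /f !catA eval_cat => /mulg1_eq E.
  rewrite eval_cat eval_winv -E invgK; move: Euv; rewrite Eu1 Ev2 !eval_cat.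
  by rewrite [eval (winv S3)]eval_winv !mulgA => ->; rewrite mulgVK.
have gS1 : geo S1 by apply: (geo_catr (u := a1)); rewrite -Eu1.
have gS3 : geo S3 by apply: (geo_catl (v := b1)); rewrite -Ev1; apply: geo_winv.
have ga1 : geo a1 by apply: (geo_catl (v := S1)); rewrite -Eu1.
have gb1 : geo b1 by apply: (geo_catr (u := S3)); rewrite -Ev1; apply: geo_winv.
have gb1' := geo_winv gb1.
have lea1 : size a1 <= l.
  by move: leu; rewrite Eu1 size_cat; case: (S1) nS1 => //= *; lia.
have leS1 := geo_half gS1 Rf'.
have leS3 : (#S3 <= 1 / 2 * #f)%R.
  have R3 : R (S3 ++ c2 ++ S1 ++ t).
    by move: Rf'; rewrite /f catA => /(R_rot symR); rewrite -!catA.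
  by have := geo_half gS3 R3; rewrite /f !size_cat !natrD; lra.
have f0 : (0 <= lam * #f)%R by apply: mulr_ge0; [exact: ltW | exact: ler0n].
(* The remainder is a bigon if [c2] is empty, and otherwise a triangle with short side [winv c2]. *)
have [ltc2 lad] : (#c2 < lam * #f)%R /\ laddered a1 (winv b1).
  case: (c2 =P [::]) => [c20|nc20].
    split; last by apply: IHA => //; move: Eab; rewrite c20 cats0.
    by rewrite c20 /= pmulr_rgt0 // ltr0n /f size_cat; case: (S1) nS1.
  have Rc2 : R (winv c2 ++ winv (S1 ++ t ++ S3)).
    by rewrite -winv_cat; apply: R_winv; rewrite // -!catA.
  have szc : (#(winv c2 ++ winv (S1 ++ t ++ S3)) = #f)%R.
    by rewrite -winv_cat size_winv -!catA.
  have rS := geo_reduced (geo_winv gv); have ru := geo_reduced gu.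
  rewrite Ev1 in rS; rewrite Eu1 in ru.
  have [ra1 rS1 ncS1] := (reduced_cat _ _).1 ru.
  have [rS3 rb1 ncS3] := (reduced_cat _ _).1 rS.
  have [] := IHB a1 (winv b1) (winv c2) (winv (S1 ++ t ++ S3)) => //.
  - by move/winv_eq0.
  - by move/winv_eq0; case: (S1) nS1.
  - rewrite winvK; apply: reduced_cat3 => //.
    + by move/winv_eq0.
    + by apply: (R_reduced hR (u := [::]) Rc2).
    + move=> d y e Ed; apply: (nc1 (winv q ++ d)).
      by rewrite Ec1 winv_cat Ed rcons_cat.
  - by rewrite winvK; apply: nocancel_cat.
  - by rewrite !winvK catA; apply: nocancel_catl.
  - rewrite szc size_winv -sf; apply: le_lt_trans ltc.
    by rewrite ler_nat Ec Ec1 !size_cat addnCA leq_addr.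
  - by rewrite szc size_winv.
rewrite Eu1 Ev2; apply: laddered_cat lad _.
(* At most half of [f] is in [S3] and less than [lam] of it in each of [t] and [c2]; the rest is
   [S1]. *)
exists f; split => //.
- by rewrite /f prefix_infix // prefix_prefix.
- rewrite sf in ltt; have szf : (#f = #S1 + #t + #S3 + #c2)%R.
    by rewrite /f !size_cat !natrD; lra.
  have : (eta * #f <= (1 / 2 - 2 * lam) * #f)%R by apply: ler_wpM2r => //;
    apply: ler0n.
  lra.
- by lra.
Qed.


Lemma natr_gt0 r : R r -> (0 < #r)%R.
Proof. by case: r => [/(R_nil hR)|x r _] //; rewrite ltr0n. Qed.

(** Every other position of the arc [s] makes it too short: a part on one geodesic is at most half
    of the cell, and a part on [t] is a piece unless the cell is the one beyond [t]. *)
Lemma shell_crosses u v t z a b s c :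
  geo u -> geo v -> t <> [::] -> z <> [::] -> R (t ++ z) ->
  nocancel u (winv z) -> nocancel (winv z) (winv v) ->
  (#t < 3 * lam * #(t ++ z))%R ->
  u ++ t ++ winv v = a ++ s ++ b -> R (s ++ c) ->
  ((1 - 3 * lam) * #(s ++ c) < #s)%R ->
  exists s1 s3, [/\ s = s1 ++ t ++ s3, u = a ++ s1, winv v = s3 ++ b,
    s1 <> [::] & s3 <> [::]].
Proof.
move=> gu gv nt nz Rtz ncu ncv ltt E Rsc lts.
have l0 : (0 < lam)%R := lam_gt0 hR.
have f0 := natr_gt0 Rsc.
have lf0 : (0 < lam * #(s ++ c))%R by apply: mulr_gt0.
have lf1 : (lam * #(s ++ c) <= 1 / 8 * #(s ++ c))%R by apply: ler_wpM2r hlam;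
  apply: ltW.
have gv' := geo_winv gv.
(* An arc from [u] into [t] has at most [1 / 2 + lam] of the cell. If the two cells agreed, [e] and
   [z] would end with the same letter, against [ncu]. *)
have left_false e t1 t2 : u = a ++ e -> s = e ++ t1 -> t = t1 ++ t2 ->
  e <> [::] -> False.
  move=> Eu Es Et ne.
  have ge : geo e by apply: (geo_catr (u := a)); rewrite -Eu.
  have le := geo_half ge (t := t1 ++ c); rewrite catA -Es in le; have {}le :=
    le Rsc.
  have R1 : R (t1 ++ c ++ e) by move: Rsc; rewrite Es -catA => /(R_rot symR);
    rewrite -catA.
  have R2 : R (t1 ++ t2 ++ z) by rewrite catA -Et.
  case: (pieceP hR R1 R2) => [H|[lt1 _]].
    case/lastP: e {Es ge le R1} ne Eu H => [//|e x] _ Eu;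
      case/lastP: z {Rtz ltt ncv R2} nz ncu => [//|z' x'] _ ncu.
    rewrite -!rcons_cat => /rcons_inj[_ Ex]; apply: (ncu (a ++ e) x (winv z')).
      by rewrite Eu rcons_cat.
    by rewrite winv_rcons Ex.
  have sf : (#(t1 ++ c ++ e) = #(s ++ c))%R by rewrite Es !size_cat !natrD; lra.
  by move: lts; rewrite [in X in (_ < X)%R -> _]Es [in X in (_ < X)%R ->
    _]size_cat natrD; rewrite sf in lt1; lra.
(* Inside [t] the arc is below [lam] of the cell, or the cells agree and it is below [3 * lam]. *)
have in_false d e : t = e ++ s ++ d -> False.
  move=> Et.
  have R2 : R (s ++ d ++ z ++ e).
    by move: Rtz; rewrite Et -!catA => /(R_rot symR); rewrite -!catA.
  case: (pieceP hR Rsc R2) => [H|[lt1 _]]; last by move: lts lt1 lf1 f0; lra.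
  have sf : (#(s ++ c) = #(t ++ z))%R by rewrite H Et !size_cat !natrD; lra.
  have : (#s <= #t)%R by rewrite ler_nat Et !size_cat addnCA leq_addr.
  by rewrite -sf in ltt; lra.
have right_false e : t ++ winv v = e ++ s ++ b -> False.
  case/cat_eq_cat => [[e' [_ Ev]]|[e' [Et E']]].
    have gs : geo s by apply: (@geo_infix _ _ _ e' s b); rewrite -Ev.
    by have := geo_half gs Rsc; move: lts lf1 f0; lra.
  case: (cat_eq_cat E') => [[d [Ed _]]|[s3 [Es Ev]]].
    by apply: (in_false d e); rewrite Et Ed.
  case: s3 Es Ev => [|x s3'] Es Ev.
    by apply: (in_false [::] e); rewrite cats0 Et Es cats0.
  move Es3: (x :: s3') Es Ev => s3 Es Ev.
  have g3 : geo s3 by apply: (geo_catl (v := b)); rewrite -Ev.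
  have R3 : R (s3 ++ c ++ e') by move: Rsc; rewrite Es -catA => /(R_rot symR);
    rewrite -catA.
  have le3 := geo_half g3 R3.
  have sf : (#(s3 ++ c ++ e') = #(s ++ c))%R by rewrite Es !size_cat !natrD;
    lra.
  rewrite sf in le3.
  have R1 : R (e' ++ s3 ++ c) by rewrite catA -Es.
  have R2 : R (e' ++ z ++ e) by move: Rtz; rewrite Et -catA => /(R_rot symR);
    rewrite -catA.
  case: (pieceP hR R1 R2) => [H|[lt1 _]].
    case: (z) nz H ncv => [//|x' z'] _; rewrite -Es3 => H.
    have [<- _] := cons_eq_cons H => ncv';
      apply: (ncv' (winv z') (linv x) (s3' ++ b)).
      by rewrite winv_cons cats1.
    by rewrite Ev -Es3 linvK.
  have sf' : (#(e' ++ s3 ++ c) = #(s ++ c))%R by rewrite catA -Es.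
  rewrite sf' in lt1; move: lts.
  by rewrite [in X in (_ < X)%R -> _]Es [in X in (_ < X)%R -> _]size_cat natrD;
    lra.
case: (cat_eq_cat E) => [[e [_ /right_false]]//|[s1 [Eu Esb]]].
case: (cat_eq_cat Esb) => [[e' [Es _]]|[s2 [Es Et]]].
  have gs : geo s by apply: (@geo_infix _ _ _ a s e'); rewrite -Es -Eu.
  by have := geo_half gs Rsc; move: lts lf1 f0; lra.
have ns1 : s1 <> [::].
  by move=> E1; apply: (right_false [::]); rewrite Es E1 -catA /= -Et.
case: (cat_eq_cat Et) => [[s3 [Es2 Ev]]|[e' [Et' _]]]; last first.
  by case: (left_false s1 s2 e').
exists s1, s3; split=> //; first by rewrite Es Es2.
move=> E3; apply: (left_false s1 t [::]) => //; last by rewrite cats0.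
by rewrite Es Es2 E3 cats0.
Qed.

Lemma triangle_step l : bigon_ladders l -> triangle_ladders l ->
  triangle_ladders l.+1.
Proof.
move=> IHA IHB u v t z leu gu gv nt nz Rtz red ncu ncv ltt Euv.
have nw : u ++ t ++ winv v <> [::] by case: (u) => //; case: (t) nt.
have [|a [s [b [c [E Rsc lts]]]]] := greendlinger_eval red nw.
  by rewrite catA eval_cat Euv eval_winv mulgV.
have [s1 [s3 [Es Eu Ev ns1 ns3]]] :=
  shell_crosses gu gv nt nz Rtz ncu ncv ltt E Rsc lts.
have Rt : R (t ++ s3 ++ c ++ s1).
  by move: Rsc; rewrite Es -catA => /(R_rot symR); rewrite -!catA.
(* If the cells on the two sides of [t] agreed, [z] and [s3] would begin with the same letter,
   against [ncv]. *)
have [H|[lt1 lt2]] := pieceP hR Rt Rtz.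
  case: s3 ns3 Ev H {Es Rt} => [//|x s3] _ Ev; case: z nz ncv {Rtz ltt ncu} =>
    [//|y z] _ ncv.
  move=> H; have [Ex _] := cons_eq_cons H;
    case: (ncv (winv z) (linv y) (s3 ++ b)).
    by rewrite winv_cons cats1.
  by rewrite Ev Ex linvK.
split=> //.
have Rf : R (s1 ++ t ++ s3 ++ c) by move: Rsc; rewrite Es -!catA.
apply: (ladder_step IHA IHB leu gu gv Eu Ev ns1 ns3 Rf) Euv.
  by move: lt1; rewrite !size_cat !natrD; lra.
by move: lts; rewrite Es !size_cat !natrD; lra.
Qed.

(** A common last edge is removed. Otherwise the boundary word is reduced, and a shell of it cannot
    lie on one geodesic, so it contains the corner: this is [ladder_step] with empty [t]. *)
Lemma bigon_step l : bigon_ladders l -> triangle_ladders l ->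
  bigon_ladders l.+1.
Proof.
move=> IHA IHB u v leu gu gv Euv.
have szuv := geo_size gu gv Euv.
case/lastP: u => [|u x] in leu gu Euv szuv *; first by [].
case/lastP: v => [|v y] in gv Euv szuv *; first by rewrite size_rcons in szuv.
case: (x =P y) => [Exy|nxy].
  rewrite Exy -!cats1 !eval_cat in Euv; move/mulIg: Euv => Euv.
  have gu' : geo u by apply: (geo_catl (v := [:: x])); rewrite cats1.
  have gv' : geo v by apply: (geo_catl (v := [:: y])); rewrite cats1.
  have szuv' := geo_size gu' gv' Euv.
  move=> n; rewrite size_rcons ltnS leq_eqVlt => /predU1P[->|lt].
    right; split; first by rewrite size_rcons -szuv'.
      by rewrite -!cats1 {2}szuv' !take_size_cat.
    by rewrite !take_oversize ?size_rcons ?szuv' // -!cats1 !eval_cat Euv Exy.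
  rewrite -!cats1.
  have [|cov|com] := IHA u v _ gu' gv' Euv n lt.
  - by rewrite size_rcons in leu.
  - by left; apply: covered_catl.
  - by right; apply: common_edge_cat.
have red : reduced (rcons u x ++ winv (rcons v y)).
  apply/reduced_cat; apply: And3.
  - exact: geo_reduced gu.
  - exact: geo_reduced (geo_winv gv).
  - move=> d x' e /rcons_inj[_ <-]; rewrite winv_rcons => H.
    by have [/(can_inj (@linvK k)) Exy _] := cons_eq_cons H; apply: nxy.
have nw : rcons u x ++ winv (rcons v y) <> [::] by case: (u).
have [|a [s [b [c [E Rsc lts]]]]] := greendlinger_eval red nw.
  by rewrite eval_cat Euv eval_winv mulgV.
have l0 : (0 < lam)%R := lam_gt0 hR.
have f0 := natr_gt0 Rsc.
have lf0 : (0 < lam * #(s ++ c))%R by apply: mulr_gt0.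
have lf1 : (lam * #(s ++ c) <= 1 / 8 * #(s ++ c))%R by apply: ler_wpM2r hlam;
  apply: ltW.
have ngs : ~ geo s.
  by move=> gs; have := geo_half gs Rsc; move: lts lf1 f0; lra.
have gv' := geo_winv gv.
case: (cat_eq_cat E) => [[e [_ Ev]]|[s1 [Eu Esb]]].
  by case: ngs; apply: (@geo_infix _ _ _ e s b); rewrite -Ev.
case: (cat_eq_cat Esb) => [[e [Es _]]|[s3 [Es Ev]]].
  by case: ngs; apply: (@geo_infix _ _ _ a s e); rewrite -Es -Eu.
apply: (ladder_step (s1 := s1) (s3 := s3) (c := c) (t :=
  [::]) IHA IHB leu gu gv Eu Ev) => //.
- move=> E1; case: ngs; rewrite Es E1; apply: (geo_catl (v := b)); rewrite -Ev;
  exact: gv'.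
- move=> E3; case: ngs; rewrite Es E3 cats0; apply: (geo_catr (u := a));
  rewrite -Eu; exact: gu.
- by rewrite /= catA -Es.
- by rewrite /= catA -Es.
- by move: lts; rewrite /= catA -Es size_cat natrD; lra.
- by rewrite cats0.
Qed.

Lemma ladders l : bigon_ladders l /\ triangle_ladders l.
Proof.
elim: l => [|l [IHA IHB]]; last by split; [apply: bigon_step |
  apply: triangle_step].
split=> [u v|u v t z]; rewrite leqn0 => /nilP ->; first by [].
move=> g0 gv nt nz Rtz red ncu ncv ltt Euv.
have nw : [::] ++ t ++ winv v <> [::] by case: (t) nt.
have [|a [s [b [c [E Rsc lts]]]]] := greendlinger_eval red nw.
  by rewrite catA eval_cat Euv eval_winv mulgV.
have [s1 [s3 [_ + _ + _]]] :=
  shell_crosses g0 gv nt nz Rtz ncu ncv ltt E Rsc lts.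
by case: a {E} => //= <-.
Qed.

Lemma geo_laddered u v : geo u -> geo v -> eval u = eval v -> laddered u v.
Proof. by have [H _] := ladders (size u); apply: H. Qed.


End Bigons.

(** * Maximal runs of a predicate on an interval *)

Section MaximalRuns.

Variables (P : nat -> Prop) (L : nat).
Implicit Types (i j n : nat).

(** Common form of the tied components of a geodesic and of the components of the union. *)
Definition maximal_run i j : Prop :=
  [/\ i < j, j <= L, forall n, i <= n < j -> P n,
      i = 0 \/ ~ P i.-1 & j = L \/ ~ P j].

Lemma maximal_run_exists n : n < L -> P n ->
  exists i j, maximal_run i j /\ i <= n < j.
Proof.
move=> ltn Pn.
have [i [lei Pi mi]] : exists i, [/\ i <= n, forall m, i <= m <= n ->
  P m & i = 0 \/ ~ P i.-1].
  elim: n Pn {ltn} => [|n IH] Pn.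
    by exists 0; split=> // [m|]; [rewrite leqn0 => /eqP-> | left].
  case: (EM (P n)) => [/IH[i [lei Pi mi]]|nPn].
    exists i; split=> //; first by rewrite ltnW.
    move=> m /andP[lim]; rewrite leq_eqVlt ltnS => /predU1P[->//|lemn].
    by apply: Pi; rewrite lim.
  exists n.+1; split=> // [m|]; last by right.
  by rewrite -eqn_leq => /eqP <-.
have [j [ltj lej Pj mj]] : exists j, [/\ n < j, j <= L, forall m, n <= m < j ->
  P m & j = L \/ ~ P j].
  move: {2}(L - n) (leqnn (L - n)) => d.
  elim: d n Pn ltn {i lei Pi mi} => [|d IH] n Pn ltn led; first by lia.
  case: (EM (n.+1 = L)) => [EL|neL].
    exists n.+1; split=> //; last by left.
    by move=> m; rewrite ltnS -eqn_leq => /eqP <-.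
  case: (EM (P n.+1)) => [Pn1|nPn].
    have [||j [ltj lej Pj mj]] := IH n.+1 Pn1; [by lia|by lia|].
    exists j; split=> //; first by lia.
    move=> m /andP[]; rewrite leq_eqVlt => /predU1P[<-//|ltm] ltmj.
    by apply: Pj; rewrite ltm.
  exists n.+1; split=> //; last by right.
  by move=> m; rewrite ltnS -eqn_leq => /eqP <-.
exists i, j; split; last by rewrite lei.
split=> //; first by lia.
move=> m /andP[lim ltmj]; case: (leqP m n) => [lemn|ltnm].
  by apply: Pi; rewrite lim.
by apply: Pj; rewrite (ltnW ltnm).
Qed.

Lemma maximal_run_subset i j a b : maximal_run i j ->
  (exists2 n, i <= n < j & a <= n < b) -> b <= L ->
  (forall n, a <= n < b -> P n) -> i <= a /\ b <= j.
Proof.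
move=> [ltij lej _ mi mj] [n] nij nab leb Pab; split; rewrite leqNgt;
  apply/negP => lt.
- by case: mi => [|nP]; [lia | apply/nP/Pab; lia].
- by case: mj => [|nP]; [lia | apply/nP/Pab; lia].
Qed.

Lemma maximal_run_eq i j i' j' : maximal_run i j -> maximal_run i' j' ->
  (exists2 n, i <= n < j & i' <= n < j') -> i = i' /\ j = j'.
Proof.
move=> r r' [n nr nr'].
have [_ lej Pij _ _] := r; have [_ lej' Pij' _ _] := r'.
have [] := maximal_run_subset r (ex_intro2 _ _ n nr nr') lej' Pij'.
have [] := maximal_run_subset r' (ex_intro2 _ _ n nr' nr) lej Pij.
by lia.
Qed.

Lemma maximal_run_lt i j i' j' : maximal_run i j -> maximal_run i' j' ->
  i < i' -> j < i'.
Proof.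
move=> [_ _ Pij _ _] [_ _ _ mi' _] lt; rewrite ltnNge; apply/negP => le.
by case: mi' => [|nP]; [lia | apply/nP/Pij; lia].
Qed.

Lemma maximal_runs : exists t : seq (nat * nat),
  sorted (fun c d : nat * nat => c.1 < d.1) t /\
  forall i j, (i, j) \in t <-> maximal_run i j.
Proof.
(* A run is determined by its start, so its end is a function of [i]; the value 0 is a default where
   no run starts. *)
pose e i := if pselect (exists j, maximal_run i j) is left H then projT1 (cid
  H) else 0.
have eP i j : maximal_run i j -> e i = j.
  move=> r; rewrite /e; case: pselect => [H|[]]; last by exists j.
  case: cid => j' r' /=; apply: (proj2 (maximal_run_eq r' r _)).
  by exists i; case: r r' => [? _ _ _ _] [? _ _ _ _]; lia.
exists [seq (i, e i) | i <- iota 0 L & `[< exists j, maximal_run i j >]]; split.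
  rewrite sorted_map; apply: (@sorted_filter _ ltn); first exact: ltn_trans.
  exact: iota_ltn_sorted.
move=> i j; split=> [/mapP[i']|r].
  by rewrite mem_filter => /andP[/asboolP[j' r] _] [-> ->]; rewrite (eP _ _ r).
apply/mapP; exists i; last by rewrite (eP _ _ r).
rewrite mem_filter mem_iota /=; apply/andP; split; first by apply/asboolP;
  exists j.
by case: r => *; lia.
Qed.

End MaximalRuns.

(** * Passing between factors and partial vertices *)

Section Factors.

Variable G : groupType.
Local Open Scope group_scope.
Implicit Types (s ps : seq (G * G)).

(** Inverse of [partial_vertices] when started at 1; [z0] is the vertex reached so far. *)
Fixpoint factors (z0 : G) ps : seq (G * G) :=
  if ps is (y, z) :: ps' then (z0^-1 * y, y^-1 * z) :: factors z ps' else [::].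

Lemma partial_vertices_cons c s : partial_vertices (c :: s) =
  (c.1, c.1 * c.2) ::
  [seq (c.1 * c.2 * p.1, c.1 * c.2 * p.2) | p <- partial_vertices s].
Proof.
rewrite /partial_vertices /= take0 big_nil big_seq1 mul1g; congr (_ :: _).
rewrite -[iota 1%N _]/(iota (1 + 0)%N _) iotaDl -!map_comp; apply: eq_map =>
  i /=.
by rewrite !big_cons mulgA.
Qed.

Lemma factorsK z0 ps :
  [seq (z0 * p.1, z0 * p.2) | p <- partial_vertices (factors z0 ps)] = ps.
Proof.
elim: ps z0 => [//|[y z] ps IH] z0; rewrite [factors _ _]/=
  partial_vertices_cons map_cons /=.
rewrite -map_comp /= !mulgA mulgV mul1g mulgV mul1g; congr (_ :: _).
rewrite -[RHS](IH z); apply: eq_map => p /=.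
by rewrite !mulgA mulgV !mul1g mulgV !mul1g.
Qed.

Lemma partial_vertices_inj : injective (@partial_vertices G).
Proof.
elim=> [|[a b] s IH] [|[a' b'] s']; rewrite ?partial_vertices_cons //=.
move=> [<- /mulgI <- H]; congr (_ :: _); apply: IH.
apply: inj_map H => -[x y] [x' y'] /= [E E'].
by rewrite (mulgI _ _ _ E) (mulgI _ _ _ E').
Qed.

Lemma prod_factors z0 ps : z0 * \prod_(c <- factors z0 ps) (c.1 * c.2) =
  last z0 (unzip2 ps).
Proof.
elim: ps z0 => [|[y z] ps IH] z0 /=; first by rewrite big_nil mulg1.
by rewrite big_cons /= mulgA !mulgA mulgV mul1g mulgV mul1g IH.
Qed.

End Factors.

(** * The decomposition read off a single geodesic *)

Section CrissCross.

Variables (F : realType) (lam eta : F) (G : groupType) (k : nat).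
Variables (gen : 'I_k -> G) (R : word k -> Prop).
Hypothesis hlam : (lam <= 1 / 8)%R.
Hypothesis hG : presents gen R.
Hypothesis hR : small_cancellation lam R.
Hypothesis heta : (eta <= 1 / 2 - 2 * lam)%R.

Implicit Types (g h : G) (u v w : word k) (a b i j m n : nat).

Notation eval := (eval gen).
Notation geo := (geo gen).
Notation covered := (covered eta R).

Lemma geodesicP h w : geodesic gen 1%g h w <-> geo w /\ eval w = h.
Proof.
rewrite /geodesic mul1g; split=> [[<- gw]|[gw <-]]; split=> // u.
  by move=> E; apply: gw; rewrite mul1g.
by rewrite mul1g => /gw.
Qed.

Lemma vertex1 w i : vertex gen 1%g w i = eval (take i w).
Proof. by rewrite /vertex mul1g. Qed.

Lemma geo_exists g : exists2 w, geo w & eval w = g.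
Proof.
have [w0 <-] := hG.1 g; move: {2}(size w0) (leqnn (size w0)) => l.
elim: l w0 => [|l IH] w.
  by rewrite leqn0 => /nilP ->; exists [::] => // u _; rewrite leq0n.
move=> lew; case: (EM (geo w)) => [gw|/existsNP[u /not_implyP[Eu /negP]]].
  by exists w.
rewrite -ltnNge => ltu; have [|v gv Ev] := IH u;
  first by rewrite -ltnS (leq_trans ltu).
by exists v; rewrite // Ev.
Qed.

Lemma geo_take w i : geo w -> geo (take i w).
Proof. by move=> gw; apply: (geo_catl (v := drop i w));
  rewrite cat_take_drop. Qed.

Lemma vertex_inj u v i j : geo u -> geo v -> i <= size u -> j <= size v ->
  eval (take i u) = eval (take j v) -> i = j.
Proof.
move=> gu gv lei lej /(geo_size (geo_take gu) (geo_take gv)).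
by rewrite !size_takel.
Qed.

Lemma size_subpath w i j : j <= size w -> size (subpath w i j) = j - i.
Proof. by move=> le; rewrite size_drop size_takel. Qed.

Lemma subpath_subpath w i j a b : i <= j -> b <= j - i ->
  subpath (subpath w i j) a b = subpath w (i + a) (i + b).
Proof.
move=> leij le; rewrite /subpath take_drop take_takel; last by lia.
by rewrite drop_drop addnC (addnC b).
Qed.

Lemma eval_subpath w i j : i <= j ->
  eval (subpath w i j) = ((eval (take i w))^-1 * eval (take j w))%g.
Proof.
move=> le; rewrite -[take j w in RHS](cat_take_drop i) take_takel // eval_cat.
by rewrite mulKg.
Qed.

Lemma geo_subpath w i j : geo w -> geo (subpath w i j).
Proof.
move=> /(geo_take (i := j)) gw; apply: (geo_catr (u := take i (take j w))).
by rewrite cat_take_drop.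
Qed.

Lemma relator_tiedP w i j : i <= j -> j <= size w ->
  relator_tied R eta (subpath w i j) <-> i < j /\ forall n, i <= n < j ->
    exists a b, [/\ i <= a, a <= n, n < b, b <= j & relator_part R eta (subpath
      w a b)].
Proof.
move=> leij lej; rewrite /relator_tied size_subpath //; split=>
  [[ne cov]|[lt cov]].
  split.
    rewrite ltnNge; apply/negP => leji; apply: ne; apply/nilP.
    by rewrite /nilp size_subpath //; lia.
  move=> n /andP[lein ltnj]; have [|a [b [le1 lt2 le3 rp]]] := cov (n - i).
    by lia.
  exists (i + a), (i + b); split; try lia.
  by rewrite -(subpath_subpath w a leij) //; move: le3; rewrite size_subpath.
split=> [/(congr1 size)|n ltn].
  by rewrite size_subpath //=; lia.
have [|a [b [le0 le1 lt2 le3 rp]]] := cov (i + n); first by lia.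
exists (a - i), (b - i); split; try lia.
by rewrite subpath_subpath ?subnKC //; lia.
Qed.

Lemma covered_interval w n : covered w n -> exists a b,
  [/\ a <= n, n < b, b <= size w, relator_part R eta (subpath w a b)
    & forall m, a <= m < b -> covered w m].
Proof.
move=> [a [b [le lt leb rp]]]; exists a, b; split=> // m /andP[leam ltmb].
by exists a, b.
Qed.

(** A relator part that meets a maximal run of covered edges stays inside it, so the run is tied;
    conversely, a covered edge next to a component would enlarge it. *)
Lemma tied_component_run w i j :
  tied_component R eta w i j <-> maximal_run (covered w) (size w) i j.
Proof.
split=> [[leij lej /(relator_tiedP leij lej) [ltij tied] maxt]|r].
  split=> //.
  - move=> n nij; have [a [b [le0 le1 lt2 le3 rp]]] := tied n nij.
    by exists a, b; split=> //; lia.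
  - case: i => [|i] in leij ltij tied maxt *; first by left.
    right=> /= /covered_interval [a [b [lea ltb leb rp _]]].
    have [||||] := maxt a (maxn b j); try lia.
    apply/relator_tiedP; [lia|lia|split; first lia].
    move=> n nab; case: (ltnP n b) => [ltnb|lebn].
      by exists a, b; split=> //; lia.
    have [|a' [b' [le0 le1 lt2 le3 rp']]] := tied n; first by lia.
    by exists a', b'; split=> //; lia.
  - case: (ltngtP j (size w)) lej => // [ltj|->] _; last by left.
    right=> /covered_interval [a [b [lea ltb leb rp _]]].
    have [||||] := maxt (minn a i) b; try lia.
    apply/relator_tiedP; [lia|lia|split; first lia].
    move=> n nab; case: (leqP a n) => [lean|ltna].
      by exists a, b; split=> //; lia.
    have [|a' [b' [le0 le1 lt2 le3 rp']]] := tied n; first by lia.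
    by exists a', b'; split=> //; lia.
have [ltij lej cov mi mj] := r; have leij := ltnW ltij.
split=> //.
  apply/relator_tiedP => //; split=> // n nij.
  have [a [b [lea ltb leb rp cab]]] := covered_interval (cov n nij).
  have [|lea' leb'] := maximal_run_subset r _ leb cab.
    by exists n => //; lia.
  by exists a, b.
move=> i' j' lei' lej' lej'w /relator_tiedP[|//|_ tied]; first by lia.
have cov' n : i' <= n < j' -> covered w n.
  move=> nij; have [a [b [le0 le1 lt2 le3 rp]]] := tied n nij.
  by exists a, b; split=> //; lia.
have [|] := maximal_run_subset r _ lej'w cov'; last by lia.
by exists i; lia.
Qed.

(** By the ladder, an uncovered edge of [u] is also an edge of [v], with the same number and the
    same ends. *)
Lemma common_vertex u v n : geo u -> geo v -> eval u = eval v -> n <= size u ->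
  [\/ n = 0, n = size u, ~ covered u n.-1 | ~ covered u n] ->
  eval (take n u) = eval (take n v).
Proof.
move=> gu gv E len; have lad := geo_laddered hlam hG hR heta gu gv E.
case: n len => [|n] len H; first by rewrite !take0.
case: (n.+1 =P size u) => [->|ne].
  by rewrite take_size E (geo_size gu gv E) take_size.
case: H => // ncov.
- by case: (lad n) => // -[].
- by case: (lad n.+1) => [||[]] //; lia.
Qed.

(* The edge number [n] of some, and then of every, geodesic from [1] to [h]
   lies in the union of the sub-geodesics [p_l, q_l]. *)
Definition cross_edge h n : Prop :=
  exists w, [/\ geo w, eval w = h, n < size w & covered w n].

(** The ends of a tied component of any geodesic are its extremities or touch an uncovered edge, so
    they are the vertices of [w] with the same numbers. *)
Lemma edge_in_unionP h w n : geo w -> eval w = h ->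
  edge_in_union gen R eta 1%g h w n <-> cross_edge h n.
Proof.
move=> gw Ew; split.
  move=> [i [j [lei lej [w' [i' [j' [/geodesicP[gw' Ew'] /tied_component_run
    r]]]]]]].
  rewrite !vertex1 => Ei Ej; have [ltij' lej' cov _ _] := r.
  have lei' : i' <= size w' by lia.
  rewrite -(vertex_inj gw' gw lei' lei Ei) -(vertex_inj gw' gw lej' lej Ej) =>
    nij.
  by exists w'; split=> //; [lia | apply: cov; lia].
move=> [w' [gw' Ew' ltn cov]].
have [i [j [r nij]]] := maximal_run_exists ltn cov.
have EE : eval w' = eval w by rewrite Ew.
have sz := geo_size gw' gw EE.
have [ltij lej _ mi mj] := r.
exists i, j; split; try lia.
exists w', i, j; split; [exact/geodesicP | exact/tied_component_run | |].
- rewrite !vertex1; apply: common_vertex => //; first by lia.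
  by case: mi => [->|]; [constructor 1 | constructor 3].
- rewrite !vertex1; apply: common_vertex => //.
  by case: mj => [->|]; [constructor 2 | constructor 4].
Qed.

Lemma union_componentP h w i j : geo w -> eval w = h ->
  union_component gen R eta 1%g h w i j <->
    maximal_run (cross_edge h) (size w) i j.
Proof.
move=> gw Ew; have EP n := edge_in_unionP n gw Ew.
split.
  by move=> [/andP[lt le] H mi mj]; split=> // [n /H/EP//||]; [case: mi |
    case: mj]; rewrite ?EP; auto.
by move=> [lt le H mi mj]; split=> [|n /H/EP//||]; [rewrite lt | case: mi |
  case: mj]; rewrite ?EP; auto.
Qed.

Lemma run_vertex h u v i j : geo u -> geo v -> eval u = h -> eval v = h ->
  maximal_run (cross_edge h) (size u) i j ->
  eval (take i u) = eval (take i v) /\ eval (take j u) = eval (take j v).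
Proof.
move=> gu gv Eu Ev [ltij lej _ mi mj].
have Euv : eval u = eval v by rewrite Eu.
have ncov n : n < size u -> ~ cross_edge h n -> ~ covered u n.
  by move=> ltn nc cov; apply: nc; exists u.
split; apply: common_vertex => //; first by lia.
  case: mi => [->|nc]; [by constructor 1 | constructor 3; apply: ncov nc; lia].
case: (j =P size u) => [->|ne]; first by constructor 2.
case: mj => [//|nc]; constructor 4; apply: ncov nc; lia.
Qed.

(** The edge numbers in the union depend on [h] alone and the ends of the runs are common vertices,
    so one geodesic serves for all. *)
Lemma criss_cross_intro h w t : geo w -> eval w = h ->
  sorted (fun c d : nat * nat => c.1 < d.1) t ->
  (forall i j, (i, j) \in t <-> maximal_run (cross_edge h) (size w) i j) ->
  criss_cross gen R eta 1%g h [seq (eval (take c.1 w), eval (take c.2 w)) |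
    c <- t].
Proof.
move=> gw Ew st tP v /geodesicP[gv Ev].
have Ewv : eval w = eval v by rewrite Ew.
have sz := geo_size gw gv Ewv.
exists t; split=> // [|i j]; last by rewrite union_componentP // -sz.
apply/eq_in_map => -[i j] /tP r /=; rewrite !vertex1.
by have [-> ->] := run_vertex gw gv Ew Ev r.
Qed.

Lemma criss_cross_uniq h s1 s2 :
  criss_cross gen R eta 1%g h s1 -> criss_cross gen R eta 1%g h s2 -> s1 = s2.
Proof.
have [w gw Ew] := geo_exists h;
  have gd : geodesic gen 1%g h w by apply/geodesicP.
move=> /(_ w gd) [t1 [-> st1 P1]] /(_ w gd) [t2 [-> st2 P2]].
congr map; apply: irr_sorted_eq st1 st2 _.
- by move=> c d e; apply: ltn_trans.
- by move=> c; apply: ltnn.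
- by move=> [i j]; apply/idP/idP => [/P1/P2|/P2/P1].
Qed.

Lemma covered_catr u v n : covered v n -> covered (u ++ v) (size u + n).
Proof.
move=> [i [j [le lt lej rp]]]; exists (size u + i), (size u + j).
split; rewrite ?leq_add2l ?ltn_add2l ?size_cat ?leq_add2l //.
rewrite /subpath take_cat ltnNge leq_addr /= addKn drop_cat ltnNge leq_addr /=.
by rewrite addKn.
Qed.

(** * Restriction to sub-geodesics *)

Section Geodesic.

Variables (g : G) (w : word k).
Hypotheses (gw : geo w) (Ew : eval w = g).
Notation V i := (eval (take i w)).
Notation h i j := ((V i)^-1 * V j)%g.

Lemma geo_reroute i j u : i <= j -> j <= size w -> geo u -> eval u = h i j ->
  [/\ size u = j - i, eval (take i w ++ u ++ drop j w) = g
    & geo (take i w ++ u ++ drop j w)].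
Proof.
move=> leij lej gu Eu.
have sz : size u = j - i.
  rewrite -(size_subpath i lej); apply: (geo_size gu (geo_subpath (i := i) (j :=
    j) gw)).
  by rewrite eval_subpath.
have E : eval (take i w ++ u ++ drop j w) = g.
  by rewrite !eval_cat Eu !mulgA mulgV mul1g -eval_cat cat_take_drop.
split=> // v Ev; have -> : size (take i w ++ u ++ drop j w) = size w.
  by rewrite !size_cat size_drop size_takel ?sz; lia.
by apply: gw; rewrite Ev E.
Qed.

(** Rerouting [w] through a geodesic of the sub-pair carries its relator parts along, shifted by
    [i]. *)
Lemma cross_edge_sub i j n : i <= j -> j <= size w -> cross_edge (h i j) n ->
  n < j - i /\ cross_edge g (i + n).
Proof.
move=> leij lej [u [gu Eu ltn cov]].
have [sz E gr] := geo_reroute leij lej gu Eu; rewrite sz in ltn; split=> //.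
exists (take i w ++ u ++ drop j w); split=> //.
  by rewrite !size_cat size_drop size_takel ?sz; lia.
have szi : size (take i w) = i by rewrite size_takel //; lia.
by have := covered_catr (take i w) (covered_catl (drop j w) cov); rewrite szi.
Qed.

Lemma compulsory_sub i j : i <= j -> j <= size w ->
  (forall n, i <= n < j -> ~ cross_edge g n) -> compulsory gen R eta (h i j).
Proof.
move=> leij lej H; have gu := geo_subpath (i := i) (j := j) gw.
have Eu := eval_subpath w leij.
apply: (criss_cross_intro (t := [::]) gu Eu) => // i' j'; split=> //
  -[lt le cov _ _].
have [|ltn ce] := cross_edge_sub leij lej (cov i' _); first by lia.
by case: (H (i + i')) => //; lia.
Qed.

(** A relator part of a geodesic [v] that covers an edge of the run consists of cross edges, so it
    cannot leave the run and survives the restriction of [v] to it. *)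
Lemma relator_covered_sub i j : maximal_run (cross_edge g) (size w) i j ->
  relator_covered gen R eta (h i j).
Proof.
move=> r; have [ltij lej ce _ _] := r; have leij := ltnW ltij.
have gu := geo_subpath (i := i) (j := j) gw; have Eu := eval_subpath w leij.
have sz := size_subpath i lej.
have ce' n : n < j - i -> cross_edge (h i j) n.
  move=> ltn; have [|v [gv Ev ltv cov]] := ce (i + n); first by lia.
  have [a [b [lea ltb leb rp cab]]] := covered_interval cov.
  have Evw : eval v = eval w by rewrite Ev.
  have szv := geo_size gv gw Evw; rewrite -szv in r lej.
  have [||lea' leb'] := maximal_run_subset r _ leb (P := cross_edge g) (a := a).
  - by exists (i + n); lia.
  - by move=> m mab; exists v; split=> //; [lia | apply: cab].
  have [Vi Vj] := run_vertex gv gw Ev Ew r.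
  exists (subpath v i j); split; [exact: geo_subpath | | |].
  - by rewrite eval_subpath // Vi Vj.
  - by rewrite size_subpath.
  exists (a - i), (b - i); rewrite size_subpath //; split; try lia.
  by rewrite subpath_subpath ?subnKC //; lia.
rewrite /relator_covered.
have -> : [:: (1%g, h i j)] = [seq (eval (take c.1 (subpath w i j)),
    eval (take c.2 (subpath w i j))) | c <- [:: (0, size (subpath w i j))]].
  by rewrite /= take0 eval_nil take_size Eu.
apply: (criss_cross_intro gu Eu) => // i' j'; rewrite inE sz.
have run0 : maximal_run (cross_edge (h i j)) (j - i) 0 (j - i).
  by split; [lia | lia | move=> n /ce' | left | left].
split=> [/eqP[-> ->]//|r']; apply/eqP.
have [|-> ->] := maximal_run_eq r' run0 => //.
by exists i'; case: r' => *; lia.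
Qed.


Notation Vs t := [seq (V c.1, V c.2) | c <- t].

Lemma V_inj i j : i <= size w -> j <= size w -> V i = V j -> i = j.
Proof. exact: vertex_inj. Qed.

Lemma V_neq i j : i < j -> j <= size w -> h i j <> 1%g.
Proof.
move=> lt le E; have : i = j; last by lia.
apply: V_inj => //; first by lia.
by apply/eqP; rewrite eq_sym -eqg_inv; apply/eqP; rewrite -[RHS]mulg1;
  apply: (mulIg (V j)); rewrite mulVg mulg1 E.
Qed.

Definition is_factor (strict : Prop) (c : G * G) : Prop :=
  [/\ strict -> c.1 <> 1%g, compulsory gen R eta c.1, c.2 <> 1%g
    & relator_covered gen R eta c.2].

(** Here [p] is the end of the preceding run, or 0 at the start. Maximal runs are separated by at
    least one edge, so only a compulsory factor starting at 0 may be trivial. *)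
Lemma factors_runs p t : p <= size w ->
  sorted (fun c d : nat * nat => c.1 < d.1) t ->
  (forall c, c \in t -> maximal_run (cross_edge g) (size w) c.1 c.2) ->
  (forall c, c \in t -> p <= c.1 /\ (0 < p -> p < c.1)) ->
  (forall n, p <= n < size w -> cross_edge g n ->
     exists2 c, c \in t & c.1 <= n < c.2) ->
  let s := factors (V p) (Vs t) in
  (forall i, i < size s -> is_factor (0 < i \/ 0 < p) (nth (1%g, 1%g) s i)) /\
  compulsory gen R eta ((last (V p) (unzip2 (Vs t)))^-1 * g)%g.
Proof.
elim: t p => [|[i j] t IH] p lep st run lept cov /=.
  split=> //; rewrite -Ew -{2}(take_size w); apply: compulsory_sub => //
    n nij ce.
  by have [] := cov n nij ce.
have r := run _ (mem_head _ _); have [/= lepi ltpi] := lept _ (mem_head _ _).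
have [/= ltij lej _ _ _] := r.
have lti c : c \in t -> i < c.1.
  move=> ct; have tr : transitive (fun c d : nat * nat => c.1 < d.1).
    by move=> c1 c2 c3; apply: ltn_trans.
  by move: st; rewrite /= path_sortedE // => /andP[/allP /(_ _ ct)].
have ltj c : c \in t -> j < c.1.
  move=> ct; apply: maximal_run_lt r _ (lti c ct).
  by apply: run; rewrite inE ct orbT.
have [|c ct|c ct|n nj ce|facs fin] := IH j lej.
- exact: path_sorted st.
- by apply: run; rewrite inE ct orbT.
- by have := ltj c ct; split; lia.
- have [|c] := cov n _ ce; first by lia.
  by rewrite inE => /predU1P[->|]; [rewrite /=; lia | exists c].
split=> // -[_|n ltn] /=; last first.
  by have [st1 ? ? ?] := facs n ltn; split=> // _; apply: st1; right; lia.
split=> /=.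
- by case=> // lt0; apply: V_neq; [apply: ltpi | lia].
- apply: compulsory_sub => //; first by lia.
  move=> n nij ce; have [|c] := cov n _ ce; first by lia.
  by rewrite inE => /predU1P[->|/lti]; rewrite /=; lia.
- exact: V_neq.
- exact: relator_covered_sub.
Qed.

End Geodesic.
End CrissCross.

(** * Existence and uniqueness of the factorization *)

Theorem theorem4p27 (F : realType) (lam eta : F) (G : groupType) (k : nat)
    (gen : 'I_k -> G) (R : word k -> Prop)
    (hlam : (lam <= 1 / 8)%R)
    (hG : presents gen R)
    (hR : small_cancellation lam R)
    (heta : (2 * lam <= eta <= 1 / 2 - 2 * lam)%R)
    (g : G) :
  exists! d : seq (G * G) * G,
    let: (s, alpha_end) := d in
    [/\ g = (\prod_(c <- s) (c.1 * c.2) * alpha_end)%g,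
        forall i, i < size s ->
          let beta := (nth (1, 1)%g s i).2 in
          beta <> 1%g /\ relator_covered gen R eta beta,
        forall i, i < size s ->
          let alpha := (nth (1, 1)%g s i).1 in
          (0 < i -> alpha <> 1%g) /\ compulsory gen R eta alpha,
        compulsory gen R eta alpha_end
      & criss_cross gen R eta 1%g g (partial_vertices s)].
Proof.
have heta' : (eta <= 1 / 2 - 2 * lam)%R by case/andP: heta.
have [w gw Ew] := geo_exists hG g.
have [t [st tP]] := maximal_runs (cross_edge eta gen R g) (size w).
pose ps := [seq (eval gen (take c.1 w), eval gen (take c.2 w)) | c <- t].
have pvE : partial_vertices (factors 1%g ps) = ps.
  rewrite -[RHS](factorsK 1%g) -[LHS]map_id; apply: eq_map => -[y z] /=.
  by rewrite !mul1g.
have cc : criss_cross gen R eta 1%g g ps.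
  exact: (criss_cross_intro hlam hG hR heta' gw Ew st tP).
have [|||] := @factors_runs _ _ _ _ _ _ _ hlam hG hR heta' _ _ gw Ew 0 t (leq0n _) st.
- by move=> [i j] /tP.
- by [].
- move=> n /= ltn ce; have [i [j [r nij]]] := maximal_run_exists ltn ce.
  by exists (i, j) => //; apply/tP.
rewrite take0 eval_nil => facs fin.
(* The last factor leads from the last [z_i], or from 1 if there is none, to [g]. *)
exists (factors 1%g ps, ((last 1 (unzip2 ps))^-1 * g)%g); split.
  split=> //.
  - by rewrite -(prod_factors 1%g ps) mul1g mulVKg.
  - by move=> i /facs[].
  - by move=> i /facs[ne co _ _]; split=> // lt; apply: ne; left.
  - by rewrite pvE.
(* The decomposition fixes the partial vertices, these fix the factors by left cancellation, and the
   product then fixes the last factor. *)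
move=> [s a] [Eg _ _ _ cc'].
have Es : factors 1%g ps = s.
  apply: partial_vertices_inj; rewrite pvE.
  exact: (criss_cross_uniq hG cc cc').
rewrite -Es in Eg *; congr pair.
by rewrite {1}Eg -(prod_factors 1%g ps) mul1g mulKg.
Qed.
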